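(* Let $n\ge1$, let $p$ be a prime and let $\lambda$ be a partition of $n$. Let $n_\lambda=\mathrm{rk}_{\mathbb{Z}}S^\lambda$. For $i\in[0,v_p(n!/n_\lambda)]$, we have an isomorphism of $\mathbb{F}_p\mathcal{S}_n$-modules $$\frac{S^\lambda_{\mathbb{F}_p}(i)}{S^\lambda_{\mathbb{F}_p}(i+1)}\;\cong\;\left(\frac{S^{\lambda'}_{\mathbb{F}_p}(v_p(n!/n_\lambda)-i)}{S^{\lambda'}_{\mathbb{F}_p}(v_p(n!/n_\lambda)-i+1)}\right)^{-}\;.$$ For $i>v_p(n!/n_\lambda)$, we have $S^\lambda_{\mathbb{F}_p}(i)/S^\lambda_{\mathbb{F}_p}(i+1)=0$.
   Context: Notation: $\lambda'$ is the transposed partition of $\lambda$; $v_p$ is the $p$-adic valuation; $[a,b]$ is the integral interval. For an $\mathcal{S}_n$-module $X$, $X^-=X\otimes_{\mathbb{Z}}S^{(1^n)}$ is the twist of $X$ by the sign module. Specht modules: a $\lambda$-tableau $[a]$ is a bijective filling of the diagram of $\lambda$ with $1,\dots,n$; a $\lambda$-tabloid $\{a\}$ is a tableau with unordered rows. $M^\lambda$ is the free $\mathbb{Z}$-module on the $\lambda$-tabloids, with $\mathcal{S}_n$ acting (on the right) on entries, and with the bilinear form $(-,=)$ for which the tabloids are orthonormal. With $C_a$ the column stabilizer of $[a]$, the polytabloid is $\langle a\rangle=\sum_{\sigma\in C_a}\varepsilon_\sigma\{a\}\sigma$ ($\varepsilon_\sigma$ the sign). $S^\lambda\subseteq M^\lambda$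 is the $\mathbb{Z}$-span of the polytabloids. $\eta:S^\lambda\to S^{\lambda,*}=\mathrm{Hom}_{\mathbb{Z}}(S^\lambda,\mathbb{Z})$, $\xi\mapsto(\xi,-)$. For a commutative ring $A$, $S^\lambda_A=A\otimes_{\mathbb{Z}}S^\lambda$. Jantzen filtration: $S^\lambda_{\mathbb{F}_p}(i)$ is the image in $S^\lambda_{\mathbb{F}_p}=S^\lambda_{\mathbb{Z}_{(p)}}/pS^\lambda_{\mathbb{Z}_{(p)}}$ of $\eta^{-1}(p^iS^{\lambda,*}_{\mathbb{Z}_{(p)}})\subseteq S^\lambda_{\mathbb{Z}_{(p)}}$, for $i\ge0$. *)

(* Defs.v *)
From HB Require Import structures.
From mathcomp Require Import all_boot all_order all_algebra all_fingroup.
From mathcomp Require Import boolp.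

Set Implicit Arguments.
Unset Strict Implicit.
Unset Printing Implicit Defensive.

Import Order.TTheory GRing.Theory Num.Theory.
Local Open Scope ring_scope.
Local Open Scope quotient_scope.

HB.mixin Record isGModule (k : nzRingType) (gT : finGroupType) V
    of GRing.Lmodule k V := {
  gact : V -> gT -> V;
  gact_linear : forall g, linear (fun v => gact v g);
  gact1 : forall v, gact v 1%g = v;
  gactM : forall v g h, gact v (g * h)%g = gact (gact v g) h
}.

#[short(type="gmodType")]
HB.structure Definition GModule (k : nzRingType) (gT : finGroupType) :=
  {V of isGModule k gT V & GRing.Lmodule k V}.

Arguments gact {k gT s}.

Section GModuleTheory.
Variables (k : nzRingType) (gT : finGroupType) (V : gmodType k gT).
Implicit Types (u v : V) (g : gT).

Lemma gactD u v g : gact (u + v) g = gact u g + gact v g.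
Proof. by have := gact_linear (s := V) g 1 u v; rewrite !scale1r. Qed.
Lemma gact0 g : gact (0 : V) g = 0.
Proof. by apply: (addrI (gact 0 g)); rewrite -gactD !addr0. Qed.
Lemma gactZ a v g : gact (a *: v) g = a *: gact v g.
Proof. by have := gact_linear (s := V) g a v 0; rewrite !addr0 gact0 addr0. Qed.
Lemma gactMn v m g : gact (v *+ m) g = gact v g *+ m.
Proof. by rewrite -!scaler_nat gactZ. Qed.
Lemma gactB u v g : gact (u - v) g = gact u g - gact v g.
Proof. by rewrite gactD -!scaleN1r gactZ. Qed.

End GModuleTheory.

Definition gmod_iso (k : nzRingType) (gT : finGroupType)
    (U V : gmodType k gT) : Prop :=
  exists f : {linear U -> V},
    bijective f /\ forall u g, f (gact u g) = gact (f u) g.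

Section SubQuotients.
Variables (k : nzRingType) (gT : finGroupType) (V : gmodType k gT).

Record submodule := Submodule {
  smem : {pred V};
  smem_submod : submod_closed smem;
  smem_gact : forall v g, v \in smem -> gact v g \in smem
}.

Implicit Types U W : submodule.

HB.instance Definition _ U := GRing.isSubmodClosed.Build k V (smem U)
  (smem_submod U).

Record sub_gmod U := SubGmod { sub_val :> V; _ : sub_val \in smem U }.

HB.instance Definition _ U := [isSub for @sub_val U].
HB.instance Definition _ U := [Choice of sub_gmod U by <:].
HB.instance Definition _ U := [SubChoice_isSubLmodule of sub_gmod U by <:].

Definition sub_gact U (v : sub_gmod U) g : sub_gmod U :=
  SubGmod (smem_gact g (valP v)).

Lemma sub_gact_linear U g : linear (fun v : sub_gmod U => sub_gact v g).
Proof. by move=> a u v; apply: val_inj; rewrite /= gact_linear. Qed.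
Lemma sub_gact1 U (v : sub_gmod U) : sub_gact v 1%g = v.
Proof. by apply: val_inj; rewrite /= gact1. Qed.
Lemma sub_gactM U (v : sub_gmod U) g h :
  sub_gact v (g * h)%g = sub_gact (sub_gact v g) h.
Proof. by apply: val_inj; rewrite /= gactM. Qed.

HB.instance Definition _ U := isGModule.Build k gT (sub_gmod U)
  (@sub_gact_linear U) (@sub_gact1 U) (@sub_gactM U).

Definition quo_gmod U : Type := {ideal_quot smem U}.

HB.instance Definition _ U := GRing.Zmodule.on (quo_gmod U).

Definition quo_pi U (v : V) : quo_gmod U := \pi_({ideal_quot smem U}) v.

Definition quo_repr U (q : quo_gmod U) : V :=
  generic_quotient.repr (q : {ideal_quot smem U}).

Lemma quo_piE U u v : (quo_pi U u = quo_pi U v) <-> (u - v \in smem U).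
Proof.
rewrite Quotient.idealrBE; split=> [e|/eqP //]; exact/eqP.
Qed.
Lemma quo_reprK U (q : quo_gmod U) : quo_pi U (quo_repr q) = q.
Proof. exact: reprK. Qed.
Lemma quo_piD U : {morph quo_pi U : u v / u + v}.
Proof. by move=> u v; rewrite /quo_pi raddfD. Qed.

Definition quo_scale U (a : k) (q : quo_gmod U) : quo_gmod U :=
  quo_pi U (a *: quo_repr q).
Definition quo_gact U (q : quo_gmod U) (g : gT) : quo_gmod U :=
  quo_pi U (gact (quo_repr q) g).

Lemma quo_piZ U a v : quo_scale a (quo_pi U v) = quo_pi U (a *: v).
Proof. by apply/quo_piE; rewrite -scalerBr rpredZ //; apply/quo_piE/quo_reprK. Qed.

Lemma quo_piJ U v g : quo_gact (quo_pi U v) g = quo_pi U (gact v g).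
Proof. by apply/quo_piE; rewrite -gactB smem_gact //; apply/quo_piE/quo_reprK. Qed.

Lemma quo_scalerA U a b (q : quo_gmod U) :
  quo_scale a (quo_scale b q) = quo_scale (a * b) q.
Proof. by rewrite -(quo_reprK q) !quo_piZ scalerA. Qed.
Lemma quo_scale1r U : left_id 1 (@quo_scale U).
Proof. by move=> q; rewrite -(quo_reprK q) quo_piZ scale1r. Qed.
Lemma quo_scalerDr U : right_distributive (@quo_scale U) +%R.
Proof.
move=> a q r; rewrite -(quo_reprK q) -(quo_reprK r) -quo_piD !quo_piZ.
by rewrite scalerDr quo_piD.
Qed.
Lemma quo_scalerDl U (q : quo_gmod U) : {morph (@quo_scale U)^~ q : a b / a + b}.
Proof.
by move=> a b; rewrite -(quo_reprK q) !quo_piZ scalerDl quo_piD.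
Qed.

HB.instance Definition _ U := GRing.Zmodule_isLmodule.Build k (quo_gmod U)
  (@quo_scalerA U) (@quo_scale1r U) (@quo_scalerDr U) (@quo_scalerDl U).

Lemma quo_pi_linear U : linear (quo_pi U).
Proof. by move=> a u v; rewrite quo_piD -quo_piZ. Qed.

HB.instance Definition _ U := GRing.isLinear.Build k V (quo_gmod U) _ (quo_pi U)
  (quo_pi_linear U).

Lemma quo_gact_linear U g : linear (fun q : quo_gmod U => quo_gact q g).
Proof.
move=> a q r; rewrite -(quo_reprK q) -(quo_reprK r) [_ *: _]quo_piZ -quo_piD.
by rewrite !quo_piJ gact_linear quo_piD -quo_piZ.
Qed.
Lemma quo_gact1 U (q : quo_gmod U) : quo_gact q 1%g = q.
Proof. by rewrite -(quo_reprK q) quo_piJ gact1. Qed.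
Lemma quo_gactM U (q : quo_gmod U) g h :
  quo_gact q (g * h)%g = quo_gact (quo_gact q g) h.
Proof. by rewrite -(quo_reprK q) !quo_piJ gactM. Qed.

HB.instance Definition _ U := isGModule.Build k gT (quo_gmod U)
  (@quo_gact_linear U) (@quo_gact1 U) (@quo_gactM U).

End SubQuotients.

Section Subquotient.
Variables (k : nzRingType) (gT : finGroupType) (V : gmodType k gT).
Variables U W : submodule V.

Definition restrict_mem : {pred sub_gmod U} :=
  [pred v : sub_gmod U | val v \in smem W].

Lemma restrict_submod : submod_closed restrict_mem.
Proof.
split=> [|a u v]; rewrite !inE ?rpred0 // => uW vW.
by rewrite /= rpredD ?rpredZ.
Qed.
Lemma restrict_gact v g : v \in restrict_mem -> gact v g \in restrict_mem.
Proof. by rewrite !inE => /smem_gact; apply. Qed.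

Definition restrict : submodule (sub_gmod U) :=
  Submodule restrict_submod restrict_gact.

(* U / (U :&: W), which is U / W when W is contained in U. *)
Definition subquo_gmod : gmodType k gT := quo_gmod restrict.

End Subquotient.

Section Reduction.
Variables (k : nzRingType) (gT : finGroupType) (V : gmodType k gT).
Variables (p : nat) (p_pr : prime p).

Definition pmul_mem : {pred V} := [pred v | `[< exists u, v = u *+ p >]].

Lemma pmul_submod : submod_closed pmul_mem.
Proof.
split=> [|a _ _ /asboolP[u ->] /asboolP[v ->]]; apply/asboolP.
  by exists 0; rewrite mul0rn.
by exists (a *: u + v); rewrite mulrnDl scalerMnr.
Qed.
Lemma pmul_gact v g : v \in pmul_mem -> gact v g \in pmul_mem.
Proof.
move=> /asboolP[u ->]; apply/asboolP; exists (gact u g).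
by rewrite gactMn.
Qed.

Definition pmul_submodule : submodule V := Submodule pmul_submod pmul_gact.

(* V / p V, on which c : 'F_p acts as multiplication by any integer lifting c *)
Definition redp of prime p : Type := quo_gmod pmul_submodule.

Local Notation Vp := (redp p_pr).

HB.instance Definition _ := GRing.Zmodule.on Vp.

Lemma redp_mulrn (q : Vp) : q *+ p = 0.
Proof.
rewrite -(quo_reprK q).
have <- : quo_pi pmul_submodule (quo_repr q *+ p) = quo_pi _ (quo_repr q) *+ p.
  by rewrite raddfMn.
have <- : quo_pi pmul_submodule 0 = 0 by exact: raddf0.
by apply/quo_piE; rewrite subr0; apply/asboolP; exists (quo_repr q).
Qed.

Lemma redp_modn (q : Vp) m : q *+ (m %% (Zp_trunc (pdiv p)).+2) = q *+ m.
Proof.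
rewrite Fp_cast //.
by rewrite [in RHS](divn_eq m p) mulrnDr mulnC mulrnA redp_mulrn mul0rn add0r.
Qed.

Definition redp_scale (c : 'F_p) (q : Vp) : Vp := q *+ c.

Lemma redp_scalerA a b (q : Vp) :
  redp_scale a (redp_scale b q) = redp_scale (a * b) q.
Proof. by rewrite /redp_scale -mulrnA /= redp_modn mulnC. Qed.
Lemma redp_scale1r : left_id 1 redp_scale.
Proof. by move=> q; rewrite /redp_scale /= redp_modn. Qed.
Lemma redp_scalerDr : right_distributive redp_scale +%R.
Proof. by move=> c q r; rewrite /redp_scale mulrnDl. Qed.
Lemma redp_scalerDl (q : Vp) : {morph redp_scale^~ q : a b / a + b}.
Proof. by move=> a b; rewrite /redp_scale /= redp_modn mulrnDr. Qed.

HB.instance Definition _ := GRing.Zmodule_isLmodule.Build 'F_p Vp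
  redp_scalerA redp_scale1r redp_scalerDr redp_scalerDl.

Definition redp_gact (q : Vp) (g : gT) : Vp :=
  gact (q : quo_gmod pmul_submodule) g.

Lemma redp_gact_linear g : linear (fun q : Vp => redp_gact q g).
Proof.
move=> c q r; rewrite /redp_gact [LHS](gactD (V := quo_gmod pmul_submodule)).
by congr (_ + _); apply: (gactMn (V := quo_gmod pmul_submodule)).
Qed.
Lemma redp_gact1 (q : Vp) : redp_gact q 1%g = q.
Proof. exact: (gact1 (s := quo_gmod pmul_submodule)). Qed.
Lemma redp_gactM (q : Vp) g h :
  redp_gact q (g * h)%g = redp_gact (redp_gact q g) h.
Proof. exact: (gactM (s := quo_gmod pmul_submodule)). Qed.

HB.instance Definition _ := isGModule.Build 'F_p gT Vp
  redp_gact_linear redp_gact1 redp_gactM.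

Variable U : submodule V.

Definition redp_image_mem : {pred Vp} :=
  [pred q | `[< exists2 v : V, v \in smem U & q = quo_pi pmul_submodule v >]].

Lemma redp_image_submod : submod_closed redp_image_mem.
Proof.
split=> [|c _ _ /asboolP[u uU ->] /asboolP[v vU ->]]; apply/asboolP.
  by exists 0; rewrite ?rpred0 //; symmetry; apply: raddf0.
exists (u *+ c + v); first by rewrite rpredD ?rpredMn.
by rewrite quo_piD; congr (_ + _); symmetry; apply: raddfMn.
Qed.
Lemma redp_image_gact q g : q \in redp_image_mem -> gact q g \in redp_image_mem.
Proof.
move=> /asboolP[v vU ->]; apply/asboolP; exists (gact v g).
  exact: smem_gact.
exact: quo_piJ.
Qed.

Definition redp_image : submodule Vp :=
  Submodule redp_image_submod redp_image_gact.

End Reduction.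

Section SignTwist.
Variables (k : nzRingType) (n : nat) (V : gmodType k 'S_n).

(* V (x) S^(1^n): as S^(1^n) is free of rank one and s acts on it by the sign
   of s, this is V with the action multiplied by the sign. *)
Definition sign_twist : Type := V.

HB.instance Definition _ := GRing.Lmodule.on sign_twist.

Definition twist_gact (v : sign_twist) (s : 'S_n) : sign_twist :=
  (-1) ^+ s *: gact (v : V) s.

Lemma twist_gact_linear s : linear (fun v => twist_gact v s).
Proof.
move=> a u v; rewrite /twist_gact gact_linear scalerDr !scalerA.
by rewrite (commr_sign a s).
Qed.
Lemma twist_gact1 v : twist_gact v 1%g = v.
Proof. by rewrite /twist_gact odd_perm1 scale1r gact1. Qed.
Lemma twist_gactM v s t : twist_gact v (s * t)%g = twist_gact (twist_gact v s) t.
Proof.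
by rewrite /twist_gact gactZ gactM scalerA odd_permM signr_addb commr_sign.
Qed.

HB.instance Definition _ := isGModule.Build k 'S_n sign_twist
  twist_gact_linear twist_gact1 twist_gactM.

End SignTwist.

Definition Zloc_mem (p : nat) : {pred rat} := [pred x | coprime p `|denq x|].

Lemma Zloc_frac p (m : int) (d : nat) :
  coprime p d -> m%:~R / d%:R \in Zloc_mem p.
Proof.
move=> cpd; rewrite inE -[d%:R]/((d : int)%:~R : rat).
have : coprime p `|(d : int)| by [].
case: divqP => [_|k x _]; first by rewrite coprimen1.
by rewrite abszM coprimeMr => /andP[].
Qed.

Lemma Zloc_subring p : subring_closed (Zloc_mem p).
Proof.
have fracE (x : rat) : x = (numq x)%:~R / `|denq x|%N%:R.
  by rewrite natr_absz normr_denq divq_num_den.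
have dE (x : rat) : `|denq x|%N%:R != 0 :> rat.
  by rewrite pnatr_eq0 absz_eq0 denq_neq0.
split=> [|x y px py|x y px py].
- by rewrite inE coprimen1.
- rewrite (fracE x) (fracE y) -mulNr addf_div // -[in X in X / _]intrN.
  rewrite !pmulrn -!intrM -intrD -PoszM -pmulrn Zloc_frac //.
  by rewrite coprimeMr; apply/andP.
- rewrite (fracE x) (fracE y) mulf_div -intrM -natrM Zloc_frac //.
  by rewrite coprimeMr; apply/andP.
Qed.

HB.instance Definition _ p := GRing.isSubringClosed.Build rat (Zloc_mem p)
  (Zloc_subring p).

(* For p prime, coprime p d means that p does not divide d, so this is Z_(p).
   With coprime, the set is a subring for every p. *)
Record Zloc (p : nat) := MkZloc { Zloc_val :> rat; _ : Zloc_val \in Zloc_mem p }.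

HB.instance Definition _ p := [isSub for @Zloc_val p].
HB.instance Definition _ p := [Choice of Zloc p by <:].
HB.instance Definition _ p := [SubChoice_isSubComNzRing of Zloc p by <:].

Definition is_part (n : nat) (lam : seq nat) : bool :=
  [&& sorted geq lam, 0%N \notin lam & sumn lam == n].

Definition conj_part (lam : seq nat) : seq nat :=
  mkseq (fun j => count (ltn j) lam) (head 0%N lam).

(* The cells of the diagram, a cell being a row index together with a column
   index in that row; both are counted from 0. *)
Definition cell (lam : seq nat) : Type :=
  {i : 'I_(size lam) & 'I_(nth 0%N lam i)}.
HB.instance Definition _ lam := Finite.on (cell lam).

Definition row_of lam (c : cell lam) : 'I_(size lam) := tag c.
Definition col_of lam (c : cell lam) : nat := tagged c.

Section Tableaux.
Variables (n : nat) (lam : seq nat).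

(* The entries are taken in {0, ..., n - 1} instead of {1, ..., n}. *)
Definition is_tableau (a : {ffun cell lam -> 'I_n}) : bool :=
  injectiveb a && [forall x, x \in codom a].

Record tableau :=
  Tableau { entry :> {ffun cell lam -> 'I_n}; _ : is_tableau entry }.
HB.instance Definition _ := [isSub for entry].
HB.instance Definition _ := [Finite of tableau by <:].

Implicit Types (a : tableau) (s : 'S_n).

Lemma tableau_act_proof a s : is_tableau [ffun c => s (a c)].
Proof.
case/andP: (valP a) => /injectiveP aI /forallP aS; apply/andP; split.
  by apply/injectiveP => c d; rewrite !ffunE => /perm_inj /aI.
apply/forallP => x; have /codomP[c e] := aS (s^-1 x)%g.
by apply/codomP; exists c; rewrite ffunE -e permKV.
Qed.
Definition tableau_act a s : tableau := Tableau (tableau_act_proof a s).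

Definition rows a : {ffun 'I_(size lam) -> {set 'I_n}} :=
  [ffun i => [set a c | c : cell lam & row_of c == i]].
Definition column a (j : nat) : {set 'I_n} :=
  [set a c | c : cell lam & col_of c == j].

(* A tabloid is the family of the (unordered) rows of some tableau. *)
Record tabloid := Tabloid {
  trows : {ffun 'I_(size lam) -> {set 'I_n}};
  _ : [exists a : tableau, trows == rows a]
}.
HB.instance Definition _ := [isSub for trows].
HB.instance Definition _ := [Finite of tabloid by <:].

Implicit Types t : tabloid.

Lemma tabloid_of_proof a : [exists b : tableau, rows a == rows b].
Proof. by apply/existsP; exists a. Qed.
Definition tabloid_of a : tabloid := Tabloid (tabloid_of_proof a).

Lemma rows_act a s : rows (tableau_act a s) = [ffun i => s @: rows a i].
Proof.
apply/ffunP => i; rewrite !ffunE -imset_comp.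
by apply: eq_imset => c; rewrite /= ffunE.
Qed.

Lemma tabloid_act_proof t s :
  [exists b : tableau, [ffun i => s @: trows t i] == rows b].
Proof.
have /existsP[a /eqP ->] := valP t.
by apply/existsP; exists (tableau_act a s); rewrite rows_act.
Qed.
Definition tabloid_act t s : tabloid := Tabloid (tabloid_act_proof t s).

Lemma tabloid_of_act a s : tabloid_of (tableau_act a s) = tabloid_act (tabloid_of a) s.
Proof. by apply: val_inj; rewrite /= rows_act. Qed.
Lemma tabloid_act1 t : tabloid_act t 1%g = t.
Proof.
apply: val_inj; apply/ffunP => i; rewrite ffunE.
by rewrite (eq_imset _ (@perm1 _)) imset_id.
Qed.
Lemma tabloid_actM t s u : tabloid_act t (s * u)%g = tabloid_act (tabloid_act t s) u.
Proof.
apply: val_inj; apply/ffunP => i; rewrite !ffunE -imset_comp.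
by apply: eq_imset => x; rewrite permM.
Qed.

Definition col_stab a : {set 'S_n} :=
  [set s : 'S_n | [forall c : cell lam,
    s @: column a (col_of c) == column a (col_of c)]].

Lemma column_act a s j : column (tableau_act a s) j = s @: column a j.
Proof.
by rewrite /column -imset_comp; apply: eq_imset => c; rewrite /= ffunE.
Qed.

Lemma col_stab_act a s u : (u ^ s \in col_stab (tableau_act a s))%g = (u \in col_stab a).
Proof.
rewrite !inE; apply: eq_forallb => c; rewrite column_act -imset_comp.
have -> : ((u ^ s)%g \o s) @: column a (col_of c) = s @: (u @: column a (col_of c)).
  by rewrite -[RHS]imset_comp; apply: eq_imset => x /=; rewrite permJ.
by rewrite (inj_eq (imset_inj perm_inj)).
Qed.

Section PermutationModule.
Variable A : comNzRingType.

(* M^lam over A: functions on the tabloids, the tabloid t being identified with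
   the function tabloid_vec t. *)
Definition permmod : Type := {ffun tabloid -> A^o}.
HB.instance Definition _ := GRing.Lmodule.on permmod.

Definition tabloid_vec t : permmod := [ffun u => (u == t)%:R].

Definition permmod_act (x : permmod) s : permmod :=
  [ffun t => x (tabloid_act t s^-1)].

Lemma permmod_act_linear s : linear (fun x => permmod_act x s).
Proof. by move=> a x y; apply/ffunP => t; rewrite !ffunE. Qed.
Lemma permmod_act1 x : permmod_act x 1%g = x.
Proof. by apply/ffunP => t; rewrite ffunE invg1 tabloid_act1. Qed.
Lemma permmod_actM x s u :
  permmod_act x (s * u)%g = permmod_act (permmod_act x s) u.
Proof. by apply/ffunP => t; rewrite !ffunE invMg tabloid_actM. Qed.

HB.instance Definition _ := isGModule.Build A 'S_n permmod
  permmod_act_linear permmod_act1 permmod_actM.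

Lemma gact_tabloid_vec t s : gact (tabloid_vec t) s = tabloid_vec (tabloid_act t s).
Proof.
apply/ffunP => u; rewrite !ffunE; congr (_ %:R); congr nat_of_bool.
by apply/eqP/eqP => [<-|->]; rewrite -tabloid_actM ?mulgV ?mulVg tabloid_act1.
Qed.

Definition form (x y : permmod) : A := \sum_t x t * y t.

Definition polytabloid a : permmod :=
  \sum_(s in col_stab a) (-1) ^+ s *: gact (tabloid_vec (tabloid_of a)) s.

Lemma gact_polytabloid a s : gact (polytabloid a) s = polytabloid (tableau_act a s).
Proof.
rewrite /polytabloid.
have -> (P : pred 'S_n) F : gact (\sum_(u | P u) F u) s = \sum_(u | P u) gact (F u) s.
  by apply: (big_morph (gact^~ s)) => [x y|]; rewrite ?gactD ?gact0.
rewrite [RHS](reindex_inj (conjg_inj s)) /=.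
apply: eq_big => [u|u _]; first by rewrite col_stab_act.
by rewrite gactZ odd_permJ tabloid_of_act -gact_tabloid_vec -!gactM -conjgC.
Qed.

Definition specht_mem : {pred permmod} :=
  [pred x | `[< exists c : tableau -> A, x = \sum_a c a *: polytabloid a >]].

Lemma specht_submod : submod_closed specht_mem.
Proof.
split=> [|z _ _ /asboolP[c ->] /asboolP[d ->]]; apply/asboolP.
  by exists (fun=> 0); rewrite big1 // => a _; rewrite scale0r.
exists (fun a => z * c a + d a); rewrite scaler_sumr -big_split /=.
by apply: eq_bigr => a _; rewrite scalerDl scalerA.
Qed.

Lemma specht_gact x s : x \in specht_mem -> gact x s \in specht_mem.
Proof.
move=> /asboolP[c ->]; apply/asboolP; exists (fun a => c (tableau_act a s^-1)).
have -> F : gact (\sum_(a : tableau) F a) s = \sum_a gact (F a) s.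
  by apply: (big_morph (gact^~ s)) => [u v|]; rewrite ?gactD ?gact0.
have tactK : cancel (tableau_act^~ s) (tableau_act^~ s^-1)%g.
  by move=> a; apply: val_inj; apply/ffunP => d; rewrite !ffunE permK.
rewrite [RHS](reindex_inj (can_inj tactK)); apply: eq_bigr => a _.
by rewrite gactZ gact_polytabloid tactK.
Qed.

Definition specht_submodule : submodule permmod :=
  Submodule specht_submod specht_gact.

(* S^lam is specht int.  For a subring A of the rationals, A is flat over Z, so
   A (x) S^lam is the A-span of the polytabloids in A (x) M^lam, as taken here.
   For other A (such as 'F_p) the definition below is not used: S^lam over 'F_p
   is the quotient specht_Fp. *)
Definition specht : gmodType A 'S_n := sub_gmod specht_submodule.

End PermutationModule.
End Tableaux.

Arguments permmod_act {n lam A}.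
Arguments tabloid_vec {n lam} A t.
Arguments polytabloid {n lam} A a.
Arguments specht_mem n lam A : clear implicits.
Arguments specht_submodule n lam A : clear implicits.
Arguments specht n lam A : clear implicits.

(* rk_Z S^lam = dim_Q (Q (x) S^lam), and Q (x) S^lam is the Q-span of the
   polytabloids. *)
Definition specht_rank (n : nat) (lam : seq nat) : nat :=
  \dim <<[seq (polytabloid rat a : {ffun tabloid n lam -> rat^o})
         | a : tableau n lam]>>%VS.

Section Jantzen.
Variables (n : nat) (lam : seq nat) (p : nat).

Local Notation Zp := (Zloc p).
Local Notation S := (specht n lam Zp).

Definition specht_dual : Type := {linear S -> Zp^o}.

Lemma form_linear (x : permmod n lam Zp) : linear (form x : _ -> Zp^o).
Proof.
move=> a y z; rewrite /form scaler_sumr -big_split; apply: eq_bigr => t _ /=.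
by rewrite !ffunE mulrDr mulrCA.
Qed.

Definition eta_fun (x y : S) : Zp^o := form (val x) (val y).
Lemma eta_fun_linear (x : S) : linear (eta_fun x).
Proof. by move=> a y z; rewrite /eta_fun form_linear. Qed.
HB.instance Definition _ (x : S) :=
  GRing.isLinear.Build Zp S Zp^o _ (eta_fun x) (eta_fun_linear x).
Definition eta (x : S) : specht_dual := eta_fun x.

Lemma form_gact (x y : permmod n lam Zp) s : form (gact x s) y = form x (gact y s^-1%g).
Proof.
have tactK : cancel (@tabloid_act n lam ^~ s) (@tabloid_act n lam ^~ s^-1%g).
  by move=> t; rewrite -tabloid_actM mulgV tabloid_act1.
rewrite /form (reindex_inj (can_inj tactK)); apply: eq_bigr => t _.
by rewrite !ffunE invgK tactK.
Qed.

(* eta^-1 (p^i S^* ) *)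
Definition jantzen_lattice_mem (i : nat) : {pred S} :=
  [pred x | `[< exists f : specht_dual, eta x =1 p%:R ^+ i \*: f >]].

Lemma jantzen_lattice_submod i : submod_closed (jantzen_lattice_mem i).
Proof.
split=> [|a x y /asboolP[f xf] /asboolP[g yg]]; apply/asboolP.
  exists (\0 : specht_dual) => y.
  rewrite /= scaler0 /eta_fun /form big1 // => t _.
  by rewrite ffunE mul0r.
exists (a \*: f \+ g : specht_dual) => z.
have xz := xf z; have yz := yg z; rewrite /= in xz yz.
rewrite /= scalerDr scalerA mulrC -scalerA -xz -yz.
rewrite /eta_fun /form scaler_sumr -big_split; apply: eq_bigr => t _ /=.
by rewrite !ffunE mulrDl -scalerAl.
Qed.

Lemma jantzen_lattice_gact i x s :
  x \in jantzen_lattice_mem i -> gact x s \in jantzen_lattice_mem i.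
Proof.
move=> /asboolP[f xf]; apply/asboolP.
pose ginv (y : S) : S := gact y s^-1%g.
have ginv_lin : linear ginv by exact: gact_linear.
pose gl := GRing.isLinear.Build Zp S S _ ginv ginv_lin.
pose ginvL : {linear S -> S} := HB.pack ginv gl.
exists (f \o ginvL : specht_dual) => y.
by have /= <- := xf (ginv y); rewrite /eta_fun form_gact.
Qed.

Definition jantzen_lattice (i : nat) : submodule S :=
  Submodule (jantzen_lattice_submod i) (@jantzen_lattice_gact i).

Variable p_pr : prime p.

(* S^lam_{F_p} = S^lam_{Z_(p)} / p S^lam_{Z_(p)} *)
Definition specht_Fp : gmodType 'F_p 'S_n := redp S p_pr.

Definition jantzen (i : nat) : submodule specht_Fp :=
  redp_image p_pr (jantzen_lattice i).

Lemma jantzenS i q : q \in smem (jantzen i.+1) -> q \in smem (jantzen i).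
Proof.
move=> /asboolP[x /asboolP[f xf] ->]; apply/asboolP; exists x => //.
apply/asboolP; exists (p%:R \*: f : specht_dual) => y.
by rewrite xf /= exprSr scalerA.
Qed.

(* S^lam_{F_p}(i) / S^lam_{F_p}(i+1) *)
Definition jantzen_quo (i : nat) : gmodType 'F_p 'S_n :=
  subquo_gmod (jantzen i) (jantzen i.+1).

End Jantzen.

(* Main.v *)
(* Fix a tableau [a] of shape [lam] and its transpose [b], and for a tabloid [t]
   of shape [lam] and a tabloid [t'] of the conjugate shape let [K t t'] be the
   sign of the permutation carrying [{a}] to [t] and [{b}] to [t'], or 0 if there
   is none.  Up to signs the columns of [K] are the polytabloids of [lam] and its
   rows are those of the conjugate partition, so over any ring the two Specht
   modules are the column and the row space of [K], and [x |-> K^T x] maps the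
   first to the second, changing the action by the sign.
   - [K K^T K = h K] for an integer [h] (both sides are sign-equivariant); taking
     the trace of [K K^T] gives [h * rank K = n`!].
   - The column space of [K] over Z_(p) is pure, and by symmetry so is the row
     space: by the Garnir relations the columns indexed by standard tableaux span
     the column space over Q, and they are unitriangular.  By purity, [x] is in
     the i-th Jantzen lattice if and only if [K^T x] is in [p ^ i] times the row
     space.
   Hence if [h = p ^ v * u] with [u] a unit, [x |-> K^T x / p ^ i] is a bijection
   from the i-th Jantzen lattice of [lam] to the (v - i)-th one of the conjugate,
   with inverse [y |-> K y / (p ^ (v - i) * u)].  It exchanges the (i + 1)-st
   lattice with the multiples of [p], and the multiples of [p] with the
   (v - i + 1)-st lattice, so it induces the isomorphism. *)

From HB Require Import structures.
Require Import Defs.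
From mathcomp Require Import all_boot all_order all_algebra all_fingroup.
From mathcomp Require Import boolp zify ring lra.

Set Implicit Arguments.
Unset Strict Implicit.
Unset Printing Implicit Defensive.

Import Order.TTheory GRing.Theory Num.Theory.
Local Open Scope ring_scope.

(* MathComp has homonyms of these two. *)
Local Notation gact := Defs.gact.
Local Notation form := Defs.form.

Local Notation tabloid_at a s := (tabloid_act (tabloid_of a) s).

(** * Positions in tableaux *)

Section Positions.
Variables (n : nat) (lam : seq nat).
Implicit Types (a d : tableau n lam) (s u : 'S_n) (x : 'I_n).

Lemma entry_inj a : injective a.
Proof. by case/andP: (valP a) => /injectiveP. Qed.

Lemma entry_codom a x : x \in codom a.
Proof. by case/andP: (valP a) => _ /forallP. Qed.

Definition entry_cell a x : cell lam := iinv (entry_codom a x).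

Lemma entry_cellK a x : a (entry_cell a x) = x.
Proof. exact: f_iinv. Qed.

Lemma cell_entryK a k : entry_cell a (a k) = k.
Proof. by apply: (@entry_inj a); rewrite entry_cellK. Qed.

Definition rowx a x : nat := row_of (entry_cell a x).
Definition colx a x : nat := col_of (entry_cell a x).

Lemma cell_eq (k l : cell lam) :
  row_of k = row_of l :> nat -> col_of k = col_of l -> k = l.
Proof.
case: k l => [i j] [i' j'] er; have {er} e : i = i' by exact: val_inj.
by subst i'; rewrite /col_of /= => /val_inj ->.
Qed.

Lemma pos_inj a x y : rowx a x = rowx a y -> colx a x = colx a y -> x = y.
Proof.
move=> r c; rewrite -(entry_cellK a x) -(entry_cellK a y).
by congr (a _); apply: cell_eq.
Qed.

Lemma mem_rows a i x : (x \in rows a i) = (rowx a x == i).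
Proof.
rewrite ffunE; apply/imsetP/eqP => [[k /[!inE] /eqP <- ->]|e].
  by rewrite /rowx cell_entryK.
by exists (entry_cell a x); rewrite ?inE ?entry_cellK // -val_eqE; apply/eqP.
Qed.

Lemma mem_column a j x : (x \in column a j) = (colx a x == j).
Proof.
apply/imsetP/eqP => [[k /[!inE] /eqP <- ->]|e].
  by rewrite /colx cell_entryK.
by exists (entry_cell a x); rewrite ?inE ?entry_cellK //; apply/eqP.
Qed.

Lemma tabloid_of_eq a d :
  (tabloid_of a = tabloid_of d) <-> (forall x, rowx a x = rowx d x).
Proof.
split=> [/(congr1 val)/= e x|e].
  have : x \in rows a (row_of (entry_cell a x)) by rewrite mem_rows.
  by rewrite e mem_rows => /eqP.
by apply: val_inj; apply/ffunP => i /=; apply/setP => x; rewrite !mem_rows e.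
Qed.

Lemma entry_cell_act a s x : entry_cell (tableau_act a s) (s x) = entry_cell a x.
Proof.
apply: (@entry_inj (tableau_act a s)).
by rewrite entry_cellK /= ffunE entry_cellK.
Qed.

Lemma rowx_act a s x : rowx (tableau_act a s) x = rowx a (s^-1%g x).
Proof. by rewrite /rowx -{1}(permKV s x) entry_cell_act. Qed.

Lemma tableau_torsor a d : exists s, d = tableau_act a s.
Proof.
have inj : injective (fun x => d (entry_cell a x)).
  move=> x y /entry_inj e; rewrite -(entry_cellK a x) -(entry_cellK a y).
  by rewrite e.
exists (perm inj); apply: val_inj; apply/ffunP => k /=.
by rewrite ffunE permE cell_entryK.
Qed.

Lemma tabloid_orbit a (t : tabloid n lam) :
  exists s, t = tabloid_act (tabloid_of a) s.
Proof.
have /existsP[d /eqP e] := valP t; have [s ed] := tableau_torsor a d.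
by exists s; rewrite -tabloid_of_act -ed; apply: val_inj.
Qed.

Lemma tabloid_act_eq a s u :
  (tabloid_act (tabloid_of a) s = tabloid_act (tabloid_of a) u) <->
  (forall x, rowx a (s^-1%g x) = rowx a (u^-1%g x)).
Proof.
rewrite -!tabloid_of_act tabloid_of_eq.
by split=> e x; have := e x; rewrite !rowx_act.
Qed.

Lemma mem_col_stab a s :
  reflect (forall x, colx a (s x) = colx a x) (s \in col_stab a).
Proof.
rewrite inE; apply: (iffP forallP) => [e x|e k].
  have xc : x \in column a (colx a x) by rewrite mem_column.
  have /eqP ec := e (entry_cell a x).
  have : s x \in column a (colx a x) by rewrite -ec imset_f.
  by rewrite mem_column => /eqP.
rewrite eqEcard card_imset ?leqnn ?andbT; last exact: perm_inj.
apply/subsetP => _ /imsetP[x xc ->]; move: xc.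
by rewrite !mem_column e.
Qed.

(** Phrased through the entries of [a], so that exchanging rows and columns carries it over to a
    transposed tableau. *)
Definition down_closed a := forall x i j,
  (i <= rowx a x)%N -> (j <= colx a x)%N ->
  exists y, rowx a y = i /\ colx a y = j.

Lemma sorted_down_closed a : sorted geq lam -> down_closed a.
Proof.
move=> srt x i j; set k := entry_cell a x => ik jk.
have isz : (i < size lam)%N by apply: leq_ltn_trans ik (ltn_ord _).
have le : (nth 0%N lam (row_of k) <= nth 0%N lam i)%N.
  have geq_trans : transitive geq by move=> ? ? ? /= h1 h2; apply: leq_trans h2 h1.
  by apply: (sorted_leq_nth geq_trans) => //; rewrite ?inE ?ltn_ord //; exact: leqnn.
have jl : (j < nth 0%N lam (Ordinal isz))%N.
  by apply: leq_trans le; apply: leq_ltn_trans jk (ltn_ord _).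
exists (a (Tagged (fun i : 'I_(size lam) => 'I_(nth 0%N lam i)) (Ordinal jl))).
by rewrite /rowx /colx !cell_entryK.
Qed.

End Positions.

Arguments down_closed {n lam}.

(** Keeping [mu] arbitrary, instead of [conj_part lam], makes the relation symmetric, so that later
    lemmas apply with the two shapes exchanged. *)
Definition transposed n lam mu (a : tableau n lam) (b : tableau n mu) : Prop :=
  [/\ down_closed a, forall x, rowx b x = colx a x
    & forall x, colx b x = rowx a x].

Lemma transposed_sym n lam mu (a : tableau n lam) (b : tableau n mu) :
  transposed a b -> transposed b a.
Proof.
case=> dc rb cb; split=> // x i j; rewrite rb cb => ic jr.
by have [y [ry cy]] := dc x j i jr ic; exists y; rewrite rb cb.
Qed.

(** The parts weakly decrease, so those exceeding [j] form an initial segment of [lam]. *)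
Lemma count_ltn_part n lam : is_part n lam -> forall j i,
  (i < count (ltn j) lam)%N = (j < nth 0%N lam i)%N.
Proof.
case/and3P => srt _ _ j; elim: lam srt => [|l lam IH] /= srt i.
  by rewrite nth_nil.
have srt' := path_sorted srt.
have c0 : (l <= j)%N -> count (ltn j) lam = 0%N.
  move=> lj; apply/eqP; rewrite -leqn0 leqNgt -has_count; apply/hasPn => m ml /=.
  rewrite -leqNgt; apply: leq_trans lj; move: m ml; apply/allP.
  by apply: order_path_min srt => ? ? ? /= h1 h2; apply: leq_trans h2 h1.
case: i => [|i] /=; case: (ltnP j l) => //= lj.
- by rewrite c0.
- by rewrite add1n ltnS IH.
- by rewrite add0n -IH // c0.
Qed.

Lemma card_cell n lam : is_part n lam -> #|{: cell lam}| = n.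
Proof.
case/and3P => _ _ /eqP <-; rewrite card_tagged !sumnE big_map enumT /=.
by rewrite [RHS](big_nth 0%N) big_mkord; apply: eq_bigr => i _; rewrite card_ord.
Qed.

Lemma exists_transposed n lam : is_part n lam ->
  exists (a : tableau n lam) (b : tableau n (conj_part lam)), transposed a b.
Proof.
move=> lamP; have cc := card_cell lamP; have [srt _ _] := and3P lamP.
have sp := count_ltn_part lamP.
pose a0 : {ffun cell lam -> 'I_n} := [ffun k => cast_ord cc (enum_rank k)].
have a0P : is_tableau a0.
  apply/andP; split.
    by apply/injectiveP => k l; rewrite !ffunE => /cast_ord_inj/enum_rank_inj.
  apply/forallP => x; apply/codomP; exists (enum_val (cast_ord (esym cc) x)).
  by rewrite ffunE enum_valK cast_ordKV.
pose a := Tableau a0P.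
pose mu := conj_part lam.
have szmu : size mu = head 0%N lam by rewrite size_mkseq.
have nthmu j : (j < size mu)%N -> nth 0%N mu j = count (ltn j) lam.
  by rewrite szmu => jl; rewrite nth_mkseq.
have tcell (k : cell mu) : (row_of k < nth 0%N lam (col_of k))%N.
  by rewrite -sp -nthmu ?ltn_ord.
have tsz (k : cell mu) : (col_of k < size lam)%N.
  by rewrite ltnNge; apply/negP => /(nth_default 0%N) e; have := tcell k; rewrite e.
pose tr (k : cell mu) : cell lam :=
  Tagged (fun i : 'I_(size lam) => 'I_(nth 0%N lam i))
    (Ordinal (tcell k : (_ < nth 0%N lam (Ordinal (tsz k)))%N)).
have rtr k : row_of (tr k) = col_of k :> nat by [].
have ctr k : col_of (tr k) = row_of k :> nat by [].
have trs (l : cell lam) : exists k, tr k = l.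
  have h1 : (col_of l < size mu)%N.
    rewrite szmu -nth0 -sp -has_count; apply/hasP; exists (nth 0%N lam (row_of l)).
      by rewrite mem_nth.
    exact: ltn_ord.
  have h2 : (row_of l < nth 0%N mu (Ordinal h1))%N.
    by rewrite (nthmu _ h1) sp; exact: ltn_ord (tagged l).
  exists (Tagged (fun i : 'I_(size mu) => 'I_(nth 0%N mu i)) (Ordinal h2)).
  exact: cell_eq.
pose b0 : {ffun cell mu -> 'I_n} := [ffun k => a (tr k)].
have b0E k : b0 k = a (tr k) by rewrite ffunE.
have b0P : is_tableau b0.
  apply/andP; split.
    apply/injectiveP => k l; rewrite !b0E => /(@entry_inj _ _ a) e.
    by apply: cell_eq; rewrite -?ctr -?rtr e.
  apply/forallP => x; apply/codomP; have [k e] := trs (entry_cell a x).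
  by exists k; rewrite b0E e entry_cellK.
pose b : tableau n mu := Tableau b0P.
have bE x : tr (entry_cell b x) = entry_cell a x.
  apply: (@entry_inj _ _ a); rewrite entry_cellK.
  by rewrite -[RHS](entry_cellK b) [RHS]b0E.
exists a, b; split; first exact: sorted_down_closed.
  by move=> x; rewrite /rowx /colx -bE.
by move=> x; rewrite /rowx /colx -bE.
Qed.

(** * The signed incidence matrix of tabloids *)

(** For transposed [a] and [b] the sum has at most one term, since row and column determine an
    entry. In this form sign-equivariance is a reindexing. *)
Definition tmat (A : comNzRingType) n lam mu (a : tableau n lam)
    (b : tableau n mu) (t : tabloid n lam) (t' : tabloid n mu) : A :=
  \sum_(s : 'S_n | (tabloid_at a s == t) && (tabloid_at b s == t')) (-1) ^+ s.

Lemma tmatC A n lam mu (a : tableau n lam) (b : tableau n mu) t t' :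
  tmat A b a t' t = tmat A a b t t'.
Proof. by apply: eq_bigl => s; rewrite andbC. Qed.

Lemma tmat_morph (A B : comNzRingType) (f : {rmorphism A -> B}) n lam mu
    (a : tableau n lam) (b : tableau n mu) t t' :
  f (tmat A a b t t') = tmat B a b t t'.
Proof. by rewrite rmorph_sum; apply: eq_bigr => s _; rewrite rmorph_sign. Qed.

Lemma tabloid_actK n lam s :
  cancel (@tabloid_act n lam ^~ s) (@tabloid_act n lam ^~ s^-1%g).
Proof. by move=> t; rewrite -tabloid_actM mulgV tabloid_act1. Qed.

Lemma tmat_act A n lam mu (a : tableau n lam) (b : tableau n mu) t t' u :
  tmat A a b (tabloid_act t u) (tabloid_act t' u) = (-1) ^+ u * tmat A a b t t'.
Proof.
rewrite /tmat (reindex_inj (mulIg u)) big_distrr /=.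
apply: eq_big => [s|s _].
  by rewrite !tabloid_actM !(inj_eq (can_inj (@tabloid_actK _ _ u))).
by rewrite odd_permM signr_addb mulrC.
Qed.

Section Combinatorics.
Variables (n : nat) (lam mu : seq nat) (a : tableau n lam) (b : tableau n mu).
Hypothesis ab : transposed a b.

Let r := rowx a.
Let c := colx a.

Lemma tabloid_at_transposedP s u :
  tabloid_at b s = tabloid_at b u <-> forall x, c (s^-1%g x) = c (u^-1%g x).
Proof.
have [_ e _] := ab; rewrite tabloid_act_eq.
by split=> h x; have := h x; rewrite !e.
Qed.

Lemma tabloid_at_inj s u : tabloid_at a s = tabloid_at a u -> tabloid_at b s = tabloid_at b u -> s = u.
Proof.
move=> /tabloid_act_eq er /tabloid_at_transposedP ec; apply: invg_inj; apply/permP => x.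
exact: (pos_inj (er x) (ec x)).
Qed.

Lemma tmat_tabloid_at A s : tmat A a b (tabloid_at a s) (tabloid_at b s) = (-1) ^+ s.
Proof.
rewrite /tmat (big_pred1 s) // => u /=; apply/andP/eqP => [[/eqP + /eqP]|-> //].
exact: tabloid_at_inj.
Qed.

Lemma tmat_neq0 A t t' : tmat A a b t t' != 0 ->
  exists s, t = tabloid_at a s /\ t' = tabloid_at b s.
Proof.
move=> nz; apply: contrapT => no; move/negP: nz; apply.
rewrite /tmat big1 // => s /andP[/eqP e /eqP e']; case: no; by exists s.
Qed.

Lemma tmat_sq A t t' : tmat A a b t t' * tmat A a b t t' =
  \sum_(s : 'S_n | (tabloid_at a s == t) && (tabloid_at b s == t')) 1.
Proof.
rewrite {1}/tmat big_distrl /=; apply: eq_bigr => s /andP[/eqP <- /eqP <-].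
by rewrite tmat_tabloid_at -signr_addb addbb.
Qed.

(** Each permutation belongs to exactly one pair of tabloids and adds its squared sign there. *)
Lemma sum_tmat_sq A :
  \sum_t \sum_t' tmat A a b t t' * tmat A a b t t' = n`!%:R.
Proof.
transitivity (\sum_(s : 'S_n) (1 : A)); last first.
  by rewrite sumr_const card_Sn.
rewrite (partition_big (fun s => tabloid_at a s) xpredT) //=; apply: eq_bigr => t _.
rewrite (partition_big (fun s => tabloid_at b s) xpredT) //=; apply: eq_bigr => t' _.
exact: tmat_sq.
Qed.

(* Weigh the position [(i, j)] by the excess of the length of row [i] over
   [j + 1/2]: this is positive exactly on the diagram, and its total over the
   positions [(r x, c (u x))] does not depend on [u]. *)
Lemma injective_in_diagram (u : 'S_n) :
  (forall x y, r x = r y -> c (u x) = c (u y) -> x = y) ->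
  forall x, exists y, r y = r x /\ c y = c (u x).
Proof.
move=> inj; have [dc _ _] := ab.
pose N := (\max_x maxn (r x) (c x)).+1.
have rN x : (r x < N)%N.
  by rewrite ltnS (leq_trans (leq_maxl _ (c x))) // (leq_bigmax x).
have cN x : (c x < N)%N.
  by rewrite ltnS (leq_trans (leq_maxr (r x) _)) // (leq_bigmax x).
pose P (v : 'S_n) x : 'I_N * 'I_N := (Ordinal (rN x), Ordinal (cN (v x))).
have P1inj : injective (P 1%g).
  by move=> x y [/= er /[!perm1] ec]; apply: (pos_inj er ec).
have Puinj : injective (P u) by move=> x y [/= er ec]; apply: inj.
(* [h i] is the length of row [i], and [F] is twice the weight, to stay integral. *)
pose h (i : nat) := \max_(x | r x == i) (c x).+1.
pose F (g : 'I_N * 'I_N) : int := 2 * (h g.1)%:Z - 2 * (g.2 : nat)%:Z - 1.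
have hP i j : (j < h i)%N -> exists x, r x = i /\ c x = j.
  move=> jh; have [x /eqP <- jx] : exists2 x, r x == i & (j <= c x)%N.
    apply: contrapT => no; move: jh; rewrite ltnNge => /negP; apply.
    apply/bigmax_leqP => x rx; rewrite ltnNge; apply/negP => jx.
    by apply: no; exists x.
  exact: dc (leqnn _) jx.
pose D := P 1%g @: setT; pose E := P u @: setT.
have sumF : \sum_(g in D) F g = \sum_(g in E) F g.
  rewrite !big_imset /=; [|by move=> ? ? _ _; exact: Puinj|by move=> ? ? _ _; exact: P1inj].
  rewrite /F /= !sumrB; congr (_ - _ - _).
  rewrite -!big_distrr /=; congr (_ * _).
  rewrite [LHS](reindex_inj (@perm_inj _ u)).
  by apply: eq_big => [x|x _]; rewrite ?inE ?perm1.
have FD g : g \in D -> 0 < F g.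
  case/imsetP => x _ ->; rewrite /F /= perm1.
  have : (c x < h (r x))%N by apply: (@leq_bigmax_cond _ _ (fun x => (c x).+1)).
  lia.
have FE g : g \notin D -> F g < 0.
  move=> gD; rewrite /F; have : (h g.1 <= g.2)%N.
    rewrite leqNgt; apply/negP => /hP[x [rx cx]]; move/negP: gD; apply.
    apply/imsetP; exists x => //; case: g rx cx => i j /= rx cx.
    by congr pair; apply: val_inj; rewrite /= ?perm1.
  by move: (nat_of_ord g.2) (h g.1) => y z; lia.
(* Cancelling the common points of [D] and [E] equates a sum of positive weights over D minus E with
   a sum of negative ones over E minus D, so the latter set is empty. *)
move: sumF; rewrite (bigID (mem E)) [RHS](bigID (mem D)) /=.
rewrite [X in _ = X + _](eq_bigl (fun g => (g \in D) && (g \in E))); last first.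
  by move=> g; rewrite andbC.
move=> /addrI eF x.
have PxD : P u x \in D.
  apply: contrapT => /negP Px.
  suff: \sum_(g in E | g \notin D) F g < 0.
    by rewrite -eF ltNge sumr_ge0 // => g /andP[/FD/ltW].
  rewrite (bigD1 (P u x)) /=; last by rewrite Px imset_f.
  rewrite -[ltRHS]addr0 ltr_leD ?FE // sumr_le0 // => g /andP[/andP[_ /FE/ltW]] //.
case/imsetP: PxD => y _ [er ec]; exists y; split; first by rewrite er.
by rewrite ec perm1.
Qed.

(** Either two entries share a row in both tabloids, and their transposition fixes both, or
    [injective_in_diagram] applies. *)
Lemma tabloid_pair_cases t t' :
  (exists s, t = tabloid_at a s /\ t' = tabloid_at b s) \/
  (exists x y, [/\ x != y, tabloid_act t (tperm x y) = t
     & tabloid_act t' (tperm x y) = t']).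
Proof.
have [s ->] := tabloid_orbit a t; have [u ->] := tabloid_orbit b t'.
pose v := (s * u^-1)%g.
have tpK m (d : tableau n m) (w : 'S_n) x y :
    rowx d (w^-1%g x) = rowx d (w^-1%g y) -> tabloid_at d (w * tperm x y)%g = tabloid_at d w.
  move=> e; apply/tabloid_act_eq => z; rewrite invMg tpermV permM.
  by case: tpermP => [->|->|].
have [[x [y [xy er ec]]]|no] := pselect (exists x y,
    [/\ x != y, r (s^-1%g x) = r (s^-1%g y) & c (u^-1%g x) = c (u^-1%g y)]).
  right; exists x, y; have [_ e _] := ab.
  by split=> //; rewrite -tabloid_actM tpK ?e.
left; have inj x y : r x = r y -> c (v x) = c (v y) -> x = y.
  rewrite /v !permM => er ec; apply/eqP/negPn/negP => xy.
  apply: no; exists (s x), (s y); rewrite !permK (inj_eq perm_inj); split=> //.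
(* [w] permutes each row of [a] and moves [x] to the column of [v x]. Hence [w^-1 * s] acts on the
   tabloid of [a] like [s], and on that of [b] like [u]. *)
have /choice[w wP] := injective_in_diagram inj.
have winj : injective w.
  move=> x y e; apply: inj; first by rewrite -(wP x).1 e (wP y).1.
  by rewrite -(wP x).2 e (wP y).2.
have wE x : r (perm winj x) = r x /\ c (perm winj x) = c (v x).
  by rewrite permE.
exists ((perm winj)^-1 * s)%g; split.
  by apply/tabloid_act_eq => x; rewrite invMg invgK permM; exact: esym (wE _).1.
by apply/tabloid_at_transposedP => x; rewrite invMg invgK permM (wE _).2 /v permM permKV.
Qed.

(* If a pair of tabloids does not come from a tableau, then some transposition
   fixes both, so that [f] vanishes on it; the other pairs form one orbit. *)
Lemma sign_equivariant_tmat (A : comNzRingType) (f : tabloid n lam -> tabloid n mu -> A) :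
  (forall x : A, x = - x -> x = 0) ->
  (forall t t' s, f (tabloid_act t s) (tabloid_act t' s) = (-1) ^+ s * f t t') ->
  forall t t', f t t' = f (tabloid_of a) (tabloid_of b) * tmat A a b t t'.
Proof.
move=> A2 fE t t'.
case: (tabloid_pair_cases t t') => [[s [-> ->]]|[x [y [xy e e']]]].
  by rewrite fE tmat_tabloid_at mulrC.
have z (g : tabloid n lam -> tabloid n mu -> A) :
    (forall t t' s, g (tabloid_act t s) (tabloid_act t' s) = (-1) ^+ s * g t t') ->
    g t t' = 0.
  move=> gE; apply: A2; have := gE t t' (tperm x y).
  by rewrite e e' odd_tperm xy expr1 mulN1r.
by rewrite (z f fE) (z (tmat A a b)) ?mulr0 // => *; apply: tmat_act.
Qed.

(* The value at [({a}, {b})] of [K K^T K], where [K] is [tmat int a b]. *)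
Definition hook_scalar : int := \sum_u \sum_u'
  tmat int a b (tabloid_of a) u' * tmat int a b u u' * tmat int a b u (tabloid_of b).

(** The left side is sign-equivariant. Concluding needs that [x = - x] forces [x = 0], so the
    identity is proved over the integers and then mapped to [A]. *)
Lemma tmat_cubed A t t' :
  \sum_u \sum_u' tmat A a b t u' * tmat A a b u u' * tmat A a b u t' =
  hook_scalar%:~R * tmat A a b t t'.
Proof.
pose f t t' : int :=
  \sum_u \sum_u' tmat int a b t u' * tmat int a b u u' * tmat int a b u t'.
have fE t1 t2 s : f (tabloid_act t1 s) (tabloid_act t2 s) = (-1) ^+ s * f t1 t2.
  rewrite /f (reindex_inj (can_inj (@tabloid_actK _ _ s))) big_distrr /=.
  apply: eq_bigr => u _.
  rewrite (reindex_inj (can_inj (@tabloid_actK _ _ s))) big_distrr /=.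
  apply: eq_bigr => u' _; rewrite !tmat_act.
  have ee : (-1) ^+ s * (-1) ^+ s = 1 :> int by rewrite -signr_addb addbb.
  by rewrite [X in X * _]mulrACA ee mul1r mulrCA.
have A2 (x : int) : x = - x -> x = 0 by lia.
have tm t1 t2 : (tmat int a b t1 t2)%:~R = tmat A a b t1 t2.
  exact: (tmat_morph (GRing.RMorphism.clone _ _ (intmul (1 : A)) _)).
have := congr1 (intmul (1 : A)) (sign_equivariant_tmat A2 fE t t').
rewrite intrM tm => <-; rewrite /f rmorph_sum /=; apply: eq_bigr => u _.
by rewrite rmorph_sum /=; apply: eq_bigr => u' _; rewrite !intrM !tm.
Qed.

End Combinatorics.

(** * Standard tableaux and the Garnir relations *)

(* A permutation [s] stands for the tableau [tableau_act a s], whose entry at the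
   position of [x] in [a] is [s x]. *)
Definition col_inc n lam (a : tableau n lam) (s : 'S_n) : Prop :=
  forall x y, colx a x = colx a y -> (rowx a x < rowx a y)%N -> (s x < s y)%N.

Definition row_inc n lam (a : tableau n lam) (s : 'S_n) : Prop :=
  forall x y, rowx a x = rowx a y -> (colx a x < colx a y)%N -> (s x < s y)%N.

(** A numerical substitute for the dominance order, depending only on the tabloid: for [b] it is the
    induction measure of straightening, for [a] it orders the standard tableaux triangularly. *)
Definition row_weight n lam (a : tableau n lam) (s : 'S_n) : nat :=
  (\sum_x rowx a x * s x)%N.

Lemma row_weightE n lam (a : tableau n lam) s :
  row_weight a s = (\sum_x rowx a (s^-1%g x) * x)%N.
Proof.
rewrite /row_weight [RHS](reindex_inj (@perm_inj _ s)).
by apply: eq_bigr => x _; rewrite permK.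
Qed.

Lemma row_weight_tabloid_at n lam (a : tableau n lam) s u :
  tabloid_at a s = tabloid_at a u -> row_weight a s = row_weight a u.
Proof.
move=> /tabloid_act_eq e; rewrite !row_weightE.
by apply: eq_bigr => x _; rewrite e.
Qed.

Section Transposed.
Variables (n : nat) (lam mu : seq nat) (a : tableau n lam) (b : tableau n mu).
Hypothesis ab : transposed a b.

Let r := rowx a.
Let c := colx a.

Lemma tabloid_at_transposedVP s u :
  tabloid_at b s = tabloid_at b u <-> forall x, c (u^-1%g (s x)) = c x.
Proof.
rewrite (tabloid_at_transposedP ab); split=> h x; first by have := h (s x); rewrite permK.
by have := h (s^-1%g x); rewrite permKV.
Qed.

Lemma col_inc_transposed s : col_inc b s <-> row_inc a s.
Proof. by have [_ er ec] := ab; split=> h x y; have := h x y; rewrite !er !ec. Qed.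

(** If a larger entry stood above a smaller one in a column, exchanging them would increase the
    weight without changing the columns. *)
Lemma row_weight_max_col_inc u :
  (forall v, tabloid_at b v = tabloid_at b u -> (row_weight a v <= row_weight a u)%N) ->
  col_inc a u.
Proof.
move=> umax x y cxy rxy.
have xy : x != y by apply: contraTneq rxy => ->; rewrite ltnn.
rewrite ltnNge; apply/negP => uyx.
have {}uyx : (u y < u x)%N.
  by rewrite ltn_neqAle uyx andbT; apply: contraNneq xy => /val_inj/perm_inj ->.
pose v := (tperm x y * u)%g.
have vb : tabloid_at b v = tabloid_at b u.
  apply/tabloid_at_transposedVP => z; rewrite permM permK.
  by case: tpermP => [->|->|].
have := umax v vb; apply/negP; rewrite -ltnNge.
have E (w : 'S_n) : row_weight a w = (rowx a x * w x + (rowx a y * w y +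
    \sum_(z | (z != x) && (z != y)) rowx a z * w z))%N.
  by rewrite /row_weight (bigD1 x) //= (bigD1 y) //= eq_sym.
rewrite (E u) (E v).
have -> : (\sum_(z | (z != x) && (z != y)) rowx a z * v z =
          \sum_(z | (z != x) && (z != y)) rowx a z * u z)%N.
  by apply: eq_bigr => z /andP[zx zy]; rewrite permM tpermD 1?eq_sym.
rewrite !permM tpermL tpermR !addnA ltn_add2r.
move: rxy uyx; rewrite -/(r x) -/(r y).
by move: (r x) (r y) (val (u x)) (val (u y)) => i j k l /=; nia.
Qed.

(** Induction down the column: the entry directly above [u x] is smaller and lies in row at least
    [k] of [v], so [u x] lies strictly below it there. *)
Lemma col_inc_leq u v : tabloid_at b u = tabloid_at b v -> col_inc a u -> col_inc a v ->
  forall x, (r x <= r (v^-1%g (u x)))%N.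
Proof.
move=> /tabloid_at_transposedVP ec ui vi; have [dc _ _] := ab.
suff H k : forall x, r x = k -> (k <= r (v^-1%g (u x)))%N by move=> x; apply: H.
elim: k => // k IH x rx.
have [y [ry cy]] := dc x k (c x) (ltac:(by rewrite -/r rx)) (leqnn _).
apply: leq_ltn_trans (IH y ry) _; rewrite ltnNge; apply/negP => le.
have uyx : (u y < u x)%N by apply: ui; rewrite // ry -/(r x) rx.
have cv : colx a (v^-1%g (u x)) = colx a (v^-1%g (u y)) by rewrite -/c !ec.
move: le; rewrite leq_eqVlt => /orP[/eqP re|rl].
  have := pos_inj re cv => /perm_inj e; by rewrite e ltnn in uyx.
by have := vi _ _ cv rl; rewrite !permKV ltnNge (ltnW uyx).
Qed.

Lemma col_inc_uniq u v : tabloid_at b u = tabloid_at b v -> col_inc a u -> col_inc a v -> u = v.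
Proof.
move=> e ui vi; apply: (tabloid_at_inj ab) => //; apply/tabloid_act_eq => x.
apply/eqP; rewrite eqn_leq; apply/andP; split.
  by have := col_inc_leq e ui vi (u^-1%g x); rewrite permKV.
by have := col_inc_leq (esym e) vi ui (v^-1%g x); rewrite permKV.
Qed.

Lemma row_weight_max_exists s : exists u, tabloid_at b u = tabloid_at b s /\
  forall v, tabloid_at b v = tabloid_at b u -> (row_weight a v <= row_weight a u)%N.
Proof.
pose P u := tabloid_at b u == tabloid_at b s.
case: (@arg_maxnP _ s P (row_weight a)) => [|u /eqP ub umax]; first exact: eqxx.
by exists u; split=> // v e; apply: umax; rewrite /P e ub.
Qed.

Lemma col_inc_exists s : exists2 u, tabloid_at b u = tabloid_at b s & col_inc a u.
Proof.
by have [u [e /row_weight_max_col_inc]] := row_weight_max_exists s; exists u.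
Qed.

(** A maximizer of the weight among the tableaux with the columns of [u] is column-increasing, hence
    is [u] by uniqueness. An [s] of the same weight is a maximizer too. *)
Lemma col_inc_weight u s : col_inc a u -> tabloid_at b s = tabloid_at b u ->
  s = u \/ (row_weight a s < row_weight a u)%N.
Proof.
move=> ui e; have [v [vb vmax]] := row_weight_max_exists u.
have ev := col_inc_uniq vb (row_weight_max_col_inc vmax) ui; subst v.
have := vmax s e; rewrite leq_eqVlt => /orP[/eqP we|]; [left|by right].
apply: (col_inc_uniq e _ ui); apply: row_weight_max_col_inc => v.
by rewrite e we; apply: vmax.
Qed.

End Transposed.

Section Garnir.
Variables (n : nat) (lam mu : seq nat) (a : tableau n lam) (b : tableau n mu).
Hypothesis ab : transposed a b.

Let r := rowx a.
Let c := colx a.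

(* By pigeonhole two entries in [u @: X] share a row of [t]; their transposition
   fixes [t] and pairs off the terms with opposite signs. *)
Lemma garnir_relation (A : comNzRingType) (u : 'S_n) (X : {set 'I_n}) (h : nat) t :
  (forall x : A, x = - x -> x = 0) ->
  (forall p q, p \in X -> c q = c p -> (r q < h)%N) -> (h < #|X|)%N ->
  \sum_(s | perm_on X s) tmat A a b t (tabloid_at b (s * u)%g) = 0.
Proof.
move=> A2 Xh hX.
have [[s0 s0X nz]|no] := pselect (exists2 s0, perm_on X s0 &
    tmat A a b t (tabloid_at b (s0 * u)%g) != 0); last first.
  rewrite big1 // => s sX; apply/eqP/negPn/negP => nz.
  by apply: no; exists s.
have [e [te /(tabloid_at_transposedP ab) ec]] := tmat_neq0 nz.
pose f p := r (e^-1%g (u p)).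
have fh p : p \in X -> (f p < h)%N.
  move=> pX; apply: (Xh (s0^-1%g p)); first by rewrite (perm_closed _ (perm_onV s0X)).
  by rewrite /c -ec invMg permM permK.
have /dinjectivePn[p pX [q /andP[/= qp qX] fpq]] : ~~ dinjectiveb f (mem X).
  apply/negP => /dinjectiveP finj; move: hX; apply/negP; rewrite -leqNgt.
  have <- : size (map f (enum X)) = #|X| by rewrite size_map -cardE.
  rewrite -[h](size_iota 0); apply: uniq_leq_size.
    rewrite map_inj_in_uniq ?enum_uniq // => x y; rewrite !mem_enum; exact: finj.
  by move=> k /mapP[x]; rewrite mem_enum mem_iota add0n => xX ->; apply: fh.
have tt : tabloid_act t (tperm (u p) (u q)) = t.
  rewrite te -tabloid_actM; apply/tabloid_act_eq => z.
  by rewrite invMg tpermV permM; case: tpermP => [->|->|].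
apply: A2; rewrite {1}(reindex_inj (mulIg (tperm p q))) /= -sumrN.
apply: eq_big => [s|s _].
  have tX : perm_on X (tperm p q).
    apply/subsetP => z; apply: contraR => zX.
    by rewrite tpermD //; apply: contraNneq zX => <-.
  apply/idP/idP => sX; last exact: perm_onM.
  by rewrite -[s](mulgK (tperm p q)) tpermV perm_onM.
have -> : (s * tperm p q * u = s * u * tperm (u p) (u q))%g.
  by rewrite -tpermJ -!mulgA -conjgC.
rewrite tabloid_actM -{1}tt tmat_act odd_tperm (inj_eq perm_inj) eq_sym qp.
by rewrite expr1 mulN1r.
Qed.

(** On [X], the entries of [u] in column [c x] exceed those in column [c y]. As [c x < c y],
    exchanges between the two columns move larger entries to the right and raise the weight; without
    exchanges the tabloid stays the same. *)
Lemma garnir_weight (u s : 'S_n) (X : {set 'I_n}) x y :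
  (c x < c y)%N -> (u y < u x)%N -> perm_on X s ->
  (forall p, p \in X -> c p = c x /\ (u x <= u p)%N \/ c p = c y /\ (u p <= u y)%N) ->
  tabloid_at b (s * u)%g = tabloid_at b u \/ (row_weight b u < row_weight b (s * u)%g)%N.
Proof.
move=> cxy uyx sX XP; have [_ rb _] := ab.
pose D z : int := (c (s^-1%g z))%:Z - (c z)%:Z.
(* The weights [E] are positive on the entries of [X] in column [c x] and
   negative on those in column [c y], as they compare [2 * u z] with
   [2 * u x - 1]. *)
pose E z : int := 2 * (u z : nat)%:Z - 2 * (u x : nat)%:Z + 1.
have sumDE : \sum_z D z * E z = 2 * ((row_weight b (s * u)%g)%:Z - (row_weight b u)%:Z).
  have e1 : (row_weight b (s * u)%g)%:Z = \sum_z (c (s^-1%g z))%:Z * (u z : nat)%:Z.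
    rewrite /row_weight (big_morph Posz PoszD (erefl 0%:Z)) [RHS](reindex_inj (@perm_inj _ s)).
    by apply: eq_bigr => z _; rewrite rb permK permM -PoszM.
  have e2 : (row_weight b u)%:Z = \sum_z (c z)%:Z * (u z : nat)%:Z.
    rewrite /row_weight (big_morph Posz PoszD (erefl 0%:Z)).
    by apply: eq_bigr => z _; rewrite rb -PoszM.
  (* [D] sums to zero, so the constant offset in [E] does not affect the sum. *)
  have e3 : \sum_z (c (s^-1%g z))%:Z = \sum_z (c z)%:Z :> int.
    by rewrite [RHS](reindex_inj (@perm_inj _ s^-1%g)).
  rewrite e1 e2 -sumrB big_distrr /=.
  rewrite -[RHS]addr0 -[X in _ + X](mulr0 (1 - 2 * (u x : nat)%:Z)).
  rewrite -[X in _ * X](subrr (\sum_z (c z)%:Z)) -{1}e3 -sumrB big_distrr -big_split /=.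
  apply: eq_bigr => z _; rewrite /D /E; ring.
have DE z : 0 <= D z * E z /\ (D z * E z = 0 -> D z = 0).
  have [zX|zX] := boolP (z \in X); last first.
    by rewrite /D (out_perm (perm_onV sX) zX) subrr mul0r.
  have szX : s^-1%g z \in X by rewrite (perm_closed _ (perm_onV sX)).
  have XP1 := XP _ zX; have XP2 := XP _ szX.
  rewrite /D /E; move: XP1 XP2 cxy uyx.
  move: (c z) (c (s^-1%g z)) (c x) (c y) (nat_of_ord (u z)) (nat_of_ord (u (s^-1%g z)))
    (nat_of_ord (u x)) (nat_of_ord (u y)) => i j k l i' j' k' l'.
  move=> h1 h2 h3 h4; split; first by nia.
  by move/eqP; rewrite mulf_eq0 => /orP[/eqP //|/eqP]; lia.
have [z0|/eqP nz] := eqVneq (\sum_z D z * E z) 0.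
  left; apply/(tabloid_at_transposedVP ab) => z; rewrite permM permK.
  move/eqP: z0; rewrite psumr_eq0 => [/allP h|w _]; last by have [] := DE w.
  have /eqP/(DE _).2 := h (s z) (mem_index_enum _).
  by rewrite /D permK => /eqP; rewrite subr_eq0 => /eqP[].
right; have : 0 <= \sum_z D z * E z by apply: sumr_ge0 => z _; have [] := DE z.
by lia.
Qed.

End Garnir.

Section Standard.
Variables (n : nat) (lam mu : seq nat) (a : tableau n lam) (b : tableau n mu).
Hypothesis ab : transposed a b.

Let r := rowx a.
Let c := colx a.

Definition standard (s : 'S_n) : Prop := col_inc a s /\ row_inc a s.

Definition std_span (f : tabloid n lam -> rat) : Prop :=
  exists d : 'S_n -> rat, (forall s, d s != 0 -> standard s) /\
    forall t, f t = \sum_s d s * tmat rat a b t (tabloid_at b s).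

Lemma std_span_lin k f g : std_span f -> std_span g ->
  std_span (fun t => k * f t + g t).
Proof.
move=> [d [dS fd]] [e [eS ge]]; exists (fun s => k * d s + e s); split=> [s nz|t].
  have [d0|/dS //] := eqVneq (d s) 0.
  by apply: eS; apply: contraNneq nz => e0; rewrite d0 e0 mulr0 addr0.
rewrite fd ge big_distrr -big_split; apply: eq_bigr => s _ /=.
by rewrite mulrDl mulrA.
Qed.

Lemma std_span_sum (I : finType) (P : pred I) (f : I -> tabloid n lam -> rat) k :
  (forall i, P i -> std_span (f i)) -> std_span (fun t => k * \sum_(i | P i) f i t).
Proof.
move=> fS.
have z : std_span (fun=> 0).
  exists (fun=> 0); split=> [s|t]; first by rewrite eqxx.
  by rewrite big1 // => s _; rewrite mul0r.
suff S rs : std_span (fun t => \sum_(i <- rs | P i) f i t).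
  have := std_span_lin k (S (index_enum I)) z; congr std_span.
  by apply: funext => t; rewrite addr0.
elim: rs => [|i rs IH].
  by move: z; congr std_span; apply: funext => t; rewrite big_nil.
have [Pi|nPi] := boolP (P i).
  have := std_span_lin 1 (fS i Pi) IH; congr std_span.
  by apply: funext => t; rewrite big_cons Pi mul1r.
by move: IH; congr std_span; apply: funext => t; rewrite big_cons (negbTE nPi).
Qed.

(** [X] is the classical Garnir set: column [c x] from [x] downwards and column [c y] from [y]
    upwards. With [h] the length of column [c x], these parts have at least [h - r x] and [r x + 1]
    elements; column [c y] is not longer than [h] by [down_closed]. *)
Lemma garnir_set_card x y : r x = r y -> (c x < c y)%N ->
  let X := [set p | (c p == c x) && (r x <= r p)%N] :|:
           [set p | (c p == c y) && (r p <= r x)%N] in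
  exists2 h, (h < #|X|)%N & forall p q, p \in X -> c q = c p -> (r q < h)%N.
Proof.
move=> rxy cxy X; have [dc _ _] := ab.
pose h := \max_(q | c q == c x) (r q).+1.
have hx q : c q = c x -> (r q < h)%N.
  by move=> /eqP cq; apply: (@leq_bigmax_cond _ _ (fun q => (r q).+1)).
have rx : (r x < h)%N by apply: hx.
exists h; last first.
  move=> p q; rewrite !inE => /orP[] /andP[/eqP -> _] cq; first exact: hx.
  have [z [rz cz]] := dc q (r q) (c x) (leqnn _) (ltac:(by rewrite -/c cq ltnW)).
  by rewrite -rz; apply: hx.
set A := [set p | _ && (r x <= _)%N] in X *; set B := [set p | _ && (_ <= r x)%N] in X *.
have disj : [disjoint A & B].
  apply/pred0P => p /=; rewrite !inE; apply/negP => /andP[/andP[/eqP e _] /andP[/eqP e' _]].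
  by move: cxy; rewrite -e e' ltnn.
have le (Z : {set 'I_n}) m k : (forall i, (m <= i < m + k)%N -> exists2 p, p \in Z & r p = i) ->
    (k <= #|Z|)%N.
  move=> ex; rewrite -[k](size_iota m) cardE -(size_map r).
  apply: uniq_leq_size (iota_uniq _ _) _ => i; rewrite mem_iota => /ex[p pZ <-].
  by apply: map_f; rewrite mem_enum.
have lA : (h - r x <= #|A|)%N.
  apply: (le _ (r x)) => i; rewrite subnKC ?(ltnW rx) // => /andP[xi ih].
  have [q /eqP cq iq] : exists2 q, c q == c x & (i <= r q)%N.
    apply: contrapT => no; move: ih; rewrite ltnNge => /negP; apply.
    apply/bigmax_leqP => q cq; rewrite ltnNge; apply/negP => iq.
    by apply: no; exists q.
  have [p [rp cp]] := dc q i (c x) iq (ltac:(by rewrite -/c cq)).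
  by exists p => //; rewrite inE /c cp eqxx /r rp.
have lB : ((r x).+1 <= #|B|)%N.
  apply: (le _ 0%N) => i; rewrite /= add0n ltnS => ix.
  have [p [rp cp]] := dc y i (c y) (ltac:(by rewrite -/r -rxy)) (leqnn _).
  by exists p => //; rewrite inE /c cp eqxx /r rp.
rewrite cardsU disjoint_setI0 // cards0 subn0.
by apply: leq_trans (leq_add lA lB); rewrite addnS subnK // ltnW.
Qed.

(** Straightening, by induction on the distance of the weight from its bound [M]. A descent in a row
    of a column-increasing tableau is removed by a Garnir relation. *)
Lemma tmat_std_span s : std_span (fun t => tmat rat a b t (tabloid_at b s)).
Proof.
have [dc rb cb] := ab.
pose M := (\sum_x rowx b x * n)%N.
have WM u : (row_weight b u <= M)%N.
  by apply: leq_sum => x _; rewrite leq_mul2l ltnW ?orbT.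
have rat2 (x : rat) : x = - x -> x = 0 by lra.
suff H k : forall s, (M - row_weight b s < k)%N ->
    std_span (fun t => tmat rat a b t (tabloid_at b s)) by apply: (H _ s (ltnSn _)).
elim: k => // k IH {}s sk; have [u us ui] := col_inc_exists ab s.
have {sk} uk : (M - row_weight b u <= k)%N by rewrite (row_weight_tabloid_at us).
rewrite -us; have [ui'|no] := pselect (row_inc a u).
  exists (fun v => (v == u)%:R); split=> [v|t].
    by have [->|_] := eqVneq v u; [split|rewrite eqxx].
  rewrite (bigD1 u) //= eqxx mul1r big1 ?addr0 // => v /negbTE ->.
  by rewrite mul0r.
have [x [y [rxy cxy uyx]]] : exists x y, [/\ r x = r y, (c x < c y)%N & (u y < u x)%N].
  apply: contrapT => no'; apply: no => x y rxy cxy; rewrite ltnNge; apply/negP => le.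
  apply: no'; exists x, y; split=> //; rewrite ltn_neqAle le andbT.
  by apply: contraTneq cxy => /val_inj/perm_inj ->; rewrite /c ltnn.
have [h hX Xh] := garnir_set_card rxy cxy.
set X := _ :|: _ in hX Xh.
have XP p : p \in X -> c p = c x /\ (u x <= u p)%N \/ c p = c y /\ (u p <= u y)%N.
  rewrite !inE => /orP[] /andP[/eqP cp]; rewrite leq_eqVlt => /orP[/eqP rp|rp].
  - by left; split=> //; rewrite (pos_inj rp (esym cp)).
  - by left; split=> //; apply/ltnW/ui.
  - by right; split=> //; rewrite (@pos_inj _ _ a p y) //; exact: etrans rp rxy.
  - by right; split=> //; apply/ltnW/ui => //; rewrite -[rowx a y]rxy.
(* The terms of the Garnir relation satisfying [Q] all equal the one to be expressed. The identity
   is among them, so their number [N] is invertible in [rat]. The other terms have larger weight. *)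
pose Q s := tabloid_at b (s * u)%g == tabloid_at b u.
pose N : rat := \sum_(s | perm_on X s && Q s) 1.
have Npos : 0 < N.
  rewrite /N (bigD1 1%g) /=; last by rewrite perm_on1 /Q mul1g eqxx.
  by rewrite ltr_pwDl // sumr_ge0.
have E t : tmat rat a b t (tabloid_at b u) =
    - N^-1 * \sum_(s | perm_on X s && ~~ Q s) tmat rat a b t (tabloid_at b (s * u)%g).
  have := garnir_relation ab u t rat2 Xh hX.
  rewrite (bigID Q) /= (eq_bigr (fun=> 1 * tmat rat a b t (tabloid_at b u))); last first.
    by move=> s' /andP[_ /eqP ->]; rewrite mul1r.
  rewrite -big_distrl /= -/N => /eqP; rewrite addr_eq0 => /eqP e.
  by rewrite mulNr -mulrN -e mulKf // gt_eqF.
have : std_span (fun t =>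
    - N^-1 * \sum_(s | perm_on X s && ~~ Q s) tmat rat a b t (tabloid_at b (s * u)%g)).
  apply: std_span_sum => s' /andP[s'X nQ]; apply: IH.
  have [/eqP e|lt] := garnir_weight ab cxy uyx s'X XP; first by rewrite /Q e in nQ.
  by apply: leq_trans uk; rewrite ltn_sub2l // (leq_trans lt).
by congr std_span; apply: funext => t; rewrite E.
Qed.

(** A nonzero entry yields [e] with the rows of [s] and the columns of [u]. If [e] differs from [u],
    its weight is smaller; otherwise [s] and [u] are row-increasing with the same rows, hence
    equal. *)
Lemma standard_triangular A s u : standard s -> standard u ->
  tmat A a b (tabloid_at a s) (tabloid_at b u) != 0 ->
  s = u \/ (row_weight a s < row_weight a u)%N.
Proof.
move=> [sc sr] [uc ur] /tmat_neq0[e [es eu]].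
have [e'|lt] := col_inc_weight ab uc (esym eu); last by right; rewrite (row_weight_tabloid_at es).
left; rewrite -e' in uc ur *; have ba := transposed_sym ab.
by apply: (col_inc_uniq ba es); apply/(col_inc_transposed ab).
Qed.

(** Downward induction on the weight: at the tabloid of [s], the sum is [d s] up to sign, plus terms
    that vanish or belong to tableaux of greater weight. *)
Lemma std_span_integral p (d : 'S_n -> rat) :
  (forall s, d s != 0 -> standard s) ->
  (forall t, \sum_s d s * tmat rat a b t (tabloid_at b s) \in Zloc_mem p) ->
  forall s, d s \in Zloc_mem p.
Proof.
move=> dS dZ.
have KZ t t' : tmat rat a b t t' \in Zloc_mem p.
  by apply: rpred_sum => s _; apply: rpredX; rewrite rpredN1.
pose M := (\max_u row_weight a u)%N.
suff H k : forall s, (M - row_weight a s < k)%N -> d s \in Zloc_mem p.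
  by move=> s; apply: (H _ s (ltnSn _)).
elim: k => // k IH s sk.
have [->|nz] := eqVneq (d s) 0; first exact: rpred0.
have := dZ (tabloid_at a s); rewrite (bigD1 s) //= (tmat_tabloid_at ab).
rewrite rpredDr.
  by case: (odd_perm s); rewrite ?expr1 ?mulrN1 ?rpredN ?expr0 ?mulr1.
apply: rpred_sum => u us.
have [->|du] := eqVneq (d u) 0; first by rewrite mul0r rpred0.
have [->|ku] := eqVneq (tmat rat a b (tabloid_at a s) (tabloid_at b u)) 0.
  by rewrite mulr0 rpred0.
apply: rpredM => //; apply: IH.
have [e|lt] := standard_triangular (dS _ nz) (dS _ du) ku.
  by rewrite e eqxx in us.
rewrite ltnS in sk; apply: leq_trans sk.
by rewrite ltn_sub2l // (leq_trans lt) //; apply: leq_bigmax.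
Qed.

End Standard.

(** * Specht modules as column spaces *)

Lemma hook_scalarC n lam mu (a : tableau n lam) (b : tableau n mu) :
  hook_scalar b a = hook_scalar a b.
Proof.
rewrite /hook_scalar exchange_big; apply: eq_bigr => u _; apply: eq_bigr => u' _.
by rewrite ![tmat _ b a _ _]tmatC mulrC mulrA mulrAC.
Qed.

Section Map.
Variables (A : comNzRingType) (n : nat) (lam mu : seq nat).
Variables (a : tableau n lam) (b : tableau n mu).

(** With K the matrix [tmat A a b], [tmap a b] is K^T and [tmap b a] is K. *)
Definition tmap (x : permmod n lam A) : permmod n mu A :=
  [ffun t' => \sum_t tmat A a b t t' * x t].

Lemma tmap_linear : linear tmap.
Proof.
move=> k x y; apply/ffunP => t'; rewrite !ffunE scaler_sumr -big_split.
apply: eq_bigr => t _ /=; rewrite !ffunE mulrDr; congr (_ + _).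
exact: mulrCA.
Qed.
HB.instance Definition _ := GRing.isLinear.Build A _ _ _ tmap tmap_linear.

Lemma tmap_vec t t' : tmap (tabloid_vec A t) t' = tmat A a b t t'.
Proof.
rewrite ffunE (bigD1 t) //= ffunE eqxx mulr1 big1 ?addr0 // => u /negbTE ut.
by rewrite ffunE ut mulr0.
Qed.

Lemma tmap_gact x s : tmap (gact x s) = (-1) ^+ s *: gact (tmap x) s.
Proof.
apply/ffunP => t'; rewrite !ffunE /= scaler_sumr.
rewrite (reindex_inj (can_inj (@tabloid_actK _ _ s))).
apply: eq_bigr => t _; rewrite !ffunE tabloid_actK.
have -> : t' = tabloid_act (tabloid_act t' s^-1) s.
  by rewrite -tabloid_actM mulVg tabloid_act1.
by rewrite tmat_act tabloid_actK -mulrA.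
Qed.

End Map.

Lemma permmod_sum (A : comNzRingType) n lam (x : permmod n lam A) :
  x = \sum_t x t *: tabloid_vec A t.
Proof.
apply/ffunP => t; rewrite sum_ffunE (bigD1 t) //= !ffunE eqxx big1.
  by rewrite addr0 /GRing.scale /= mulr1.
by move=> u /negbTE ut; rewrite !ffunE eq_sym ut; exact: mulr0.
Qed.

Lemma form_tmap (A : comNzRingType) n lam mu (a : tableau n lam) (b : tableau n mu)
    (x : permmod n lam A) (z : permmod n mu A) :
  form (tmap b a z) x = form z (tmap a b x).
Proof.
rewrite /form; under eq_bigr do rewrite ffunE big_distrl.
under [RHS]eq_bigr do rewrite ffunE big_distrr.
rewrite exchange_big; apply: eq_bigr => t' _; apply: eq_bigr => t _ /=.
by rewrite tmatC mulrAC mulrC mulrCA mulrA mulrC.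
Qed.

HB.instance Definition _ n lam (A : comNzRingType) := GRing.isSubmodClosed.Build A
  (permmod n lam A) (specht_mem n lam A) (@specht_submod n lam A).

Section SpechtImage.
Variables (n : nat) (lam mu : seq nat) (a : tableau n lam) (b : tableau n mu).
Hypothesis ab : transposed a b.

(** The column stabilizer of [a] is the stabilizer of the tabloid of [b], so the polytabloid of [a]
    is the column of K at that tabloid. Equivariance gives the others. *)
Lemma polytabloid_tmap A s :
  polytabloid A (tableau_act a s) = (-1) ^+ s *: tmap b a (tabloid_vec A (tabloid_at b s)).
Proof.
have base : polytabloid A a = tmap b a (tabloid_vec A (tabloid_of b)).
  apply/ffunP => t; rewrite tmap_vec tmatC sum_ffunE /tmat.
  rewrite [RHS]big_mkcondl [LHS](eq_bigl (fun u => tabloid_at b u == tabloid_of b)).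
    apply: eq_bigr => u _; rewrite gact_tabloid_vec !ffunE eq_sym.
    by case: eqP => _; [exact: mulr1|exact: mulr0].
  move=> u; rewrite -[X in _ == X]tabloid_act1.
  have e := tabloid_at_transposedVP ab u 1.
  apply/mem_col_stab/eqP => [h|/e h x]; last by rewrite -[RHS]h invg1 perm1.
  by apply/e => x; rewrite invg1 perm1.
rewrite -gact_polytabloid base -gact_tabloid_vec tmap_gact scalerA.
by rewrite -signr_addb addbb scale1r.
Qed.

Lemma polytabloid_specht A (d : tableau n lam) : polytabloid A d \in specht_mem n lam A.
Proof.
apply/asboolP; exists (fun e => (e == d)%:R).
rewrite (bigD1 d) //= eqxx scale1r big1 ?addr0 // => e /negbTE ->.
by rewrite scale0r.
Qed.

Lemma spechtP A (x : permmod n lam A) :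
  x \in specht_mem n lam A <-> exists z, x = tmap b a z.
Proof.
split=> [/asboolP[k ->]|[z ->]].
  have /boolp.choice[z zE] (d : tableau n lam) :
      exists z, polytabloid A d = tmap b a z.
    have [s ->] := tableau_torsor a d.
    by eexists; rewrite polytabloid_tmap -linearZ.
  exists (\sum_d k d *: z d); rewrite linear_sum; apply: eq_bigr => d _.
  by rewrite linearZ zE.
rewrite [z]permmod_sum linear_sum.
apply: rpred_sum => t' _; rewrite linearZ /= rpredZ //.
have [s ->] := tabloid_orbit b t'.
have -> : tmap b a (tabloid_vec A (tabloid_at b s)) = (-1) ^+ s *: polytabloid A (tableau_act a s).
  by rewrite polytabloid_tmap scalerA -signr_addb addbb scale1r.
by rewrite rpredZ //; apply: polytabloid_specht.
Qed.

Lemma tmap_cubed A (z : permmod n mu A) :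
  tmap b a (tmap a b (tmap b a z)) = (hook_scalar a b)%:~R *: tmap b a z.
Proof.
rewrite [z]permmod_sum !linear_sum; apply: eq_bigr => t' _; rewrite !linearZ /=.
congr (_ *: _); apply/ffunP => t.
transitivity ((hook_scalar a b)%:~R * tmat A a b t t'); last first.
  by rewrite [RHS]ffunE tmap_vec tmatC.
rewrite -(tmat_cubed ab) ffunE exchange_big; apply: eq_bigr => u _ /=.
rewrite ffunE big_distrr; apply: eq_bigr => u' _ /=.
by rewrite tmap_vec ![tmat _ b a _ _]tmatC mulrA.
Qed.

Lemma tmap_tmap A x : x \in specht_mem n lam A ->
  tmap b a (tmap a b x) = (hook_scalar a b)%:~R *: x.
Proof. by move=> /spechtP[z ->]; apply: tmap_cubed. Qed.

End SpechtImage.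

(** * Purity and the Jantzen lattices *)

Section Purity.
Variables (n : nat) (lam mu : seq nat) (a : tableau n lam) (b : tableau n mu).
Hypothesis ab : transposed a b.
Variable p : nat.

(** Dividing by [k] over the rationals makes [x] a combination of standard columns of K. Since [x]
    has values in Z_(p), so do the coefficients, by unitriangularity. *)
Lemma specht_pure (k : Zloc p) (x : permmod n lam (Zloc p)) :
  k != 0 -> k *: x \in specht_mem n lam (Zloc p) ->
  x \in specht_mem n lam (Zloc p).
Proof.
move=> k0 /(spechtP ab)[z kx].
have vk0 : val k != 0 by apply: contraNneq k0 => e; apply/eqP/val_inj.
have vK t t' : val (tmat (Zloc p) a b t t') = tmat rat a b t t'.
  exact: (tmat_morph (GRing.RMorphism.clone _ _ (val : Zloc p -> rat) _)).
have [d [dS xd]] : std_span a b (fun t => val (x t)).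
  (* The [+ 0] gives the summands the form that [std_span_lin] produces. *)
  have : std_span a b (fun t => (val k)^-1 *
      \sum_t' (val (z t') * tmat rat a b t t' + 0)).
    apply: std_span_sum => t' _; have [s ->] := tabloid_orbit b t'.
    apply: std_span_lin (tmat_std_span ab s) _; exists (fun=> 0).
    split=> [u|t]; first by rewrite eqxx.
    by rewrite big1 // => u _; rewrite mul0r.
  congr std_span; apply: funext => t.
  have e : k * x t = \sum_t' tmat (Zloc p) b a t' t * z t'.
    by have := congr1 (fun f : permmod n lam (Zloc p) => f t) kx; rewrite !ffunE.
  rewrite -[RHS](mulKf vk0) -[val k * val (x t)]/(val (k * x t)) e raddf_sum /=.
  congr (_ * _).
  by apply: eq_bigr => t' _; rewrite addr0 -vK [RHS]mulrC [in LHS]tmatC.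
have dZ : forall s, d s \in Zloc_mem p.
  by apply: (std_span_integral ab dS) => t; rewrite -xd; apply: valP.
apply/(spechtP ab); exists (\sum_s MkZloc (dZ s) *: tabloid_vec (Zloc p) (tabloid_at b s)).
apply/ffunP => t; apply: val_inj; rewrite xd linear_sum sum_ffunE raddf_sum.
apply: eq_bigr => s _; rewrite -vK linearZ [in RHS]ffunE tmap_vec.
by rewrite [in RHS]tmatC.
Qed.

End Purity.

Lemma Zloc_pX_neq0 p (p_pr : prime p) i : (p%:R : Zloc p) ^+ i != 0.
Proof.
pose v := GRing.RMorphism.clone _ _ (val : Zloc p -> rat) _.
apply/negP => /eqP/(congr1 v); rewrite rmorphXn rmorph_nat rmorph0 => /eqP.
by rewrite expf_eq0 pnatr_eq0 (gtn_eqF (prime_gt0 p_pr)) andbF.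
Qed.

Lemma tmap_specht n lam mu (a : tableau n lam) (b : tableau n mu)
    (ab : transposed a b) A x : tmap (A := A) a b x \in specht_mem n mu A.
Proof. by apply/(spechtP (transposed_sym ab)); exists x. Qed.

Lemma jantzen_latticeP n lam mu (a : tableau n lam) (b : tableau n mu)
    (ab : transposed a b) p (p_pr : prime p) i (x : specht n lam (Zloc p)) :
  x \in smem (jantzen_lattice n lam p i) <->
  exists y : specht n mu (Zloc p), tmap a b (val x) = p%:R ^+ i *: val y.
Proof.
have ba := transposed_sym ab; split=> [/asboolP[f xf]|[y xy]].
  (* [v t'] is the column of K at [t']; pairing [x] with it gives the coordinate of K^T x at
     [t']. *)
  pose v t' : specht n lam (Zloc p) := 
    @SubGmod _ _ _ (specht_submodule n lam (Zloc p)) _ (tmap_specht ba (tabloid_vec _ t')).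
  pose y : permmod n mu (Zloc p) := [ffun t' => f (v t')].
  have e : tmap a b (val x) = p%:R ^+ i *: y.
    apply/ffunP => t'; rewrite [RHS]ffunE [in RHS]ffunE.
    have /= <- := xf (v t'); rewrite /eta_fun /= /form.
    under eq_bigr do rewrite mulrC; rewrite -[RHS]/(form _ _) form_tmap.
    rewrite /form (bigD1 t') //= [tabloid_vec _ t' t']ffunE eqxx mul1r.
    rewrite big1 ?addr0 // => u /negbTE ut.
    by rewrite ffunE ut mul0r.
  have yS : y \in specht_mem n mu (Zloc p).
    by apply: (specht_pure ba (Zloc_pX_neq0 p_pr i)); rewrite -e tmap_specht.
  by exists (@SubGmod _ _ _ (specht_submodule n mu (Zloc p)) _ yS).
(* Pairing with a preimage [z] of [y] under K^T is the required functional: its value at K w' is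
   [form w' y]. *)
have [z yz] := (spechtP ba _).1 (valP y).
pose g (w : specht n lam (Zloc p)) : (Zloc p)^o := form z (val w).
have g_lin : linear g by move=> k u v; apply: form_linear.
pose gl := GRing.isLinear.Build _ _ _ _ g g_lin.
pose G : {linear specht n lam (Zloc p) -> (Zloc p)^o} := HB.pack g gl.
have formC m (u v : permmod n m (Zloc p)) : form u v = form v u.
  by apply: eq_bigr => t _; rewrite mulrC.
apply/asboolP; exists G => w; rewrite /= /g /eta_fun.
have [w' ->] := (spechtP ab _).1 (valP w).
rewrite formC [form z _]formC !form_tmap xy yz.
by have := form_linear w' (p%:R ^+ i) (tmap a b z) 0; rewrite !addr0 => ->;
  rewrite [form _ 0]big1 ?addr0 // => t _; rewrite ffunE mulr0.
Qed.

(** * The trace of K K^T and the rank *)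

Lemma tmap_sum_diag n lam mu (a : tableau n lam) (b : tableau n mu) A :
  transposed a b -> \sum_t tmap b a (tmap a b (tabloid_vec A t)) t = n`!%:R.
Proof.
move=> ab; rewrite -(sum_tmat_sq ab); apply: eq_bigr => t _; rewrite ffunE.
by apply: eq_bigr => t' _; rewrite tmap_vec [tmat _ b a _ _]tmatC.
Qed.

(** The endomorphism [E], which is K K^T, maps into the rational Specht module [U] and is
    multiplication by the scalar there. Its trace is computed over the tabloids and over a basis of
    [U]. *)
Lemma hook_scalar_rank n lam mu (a : tableau n lam) (b : tableau n mu) :
  transposed a b -> hook_scalar a b * (specht_rank n lam)%:Z = n`!%:Z.
Proof.
move=> ab; apply: (@intr_inj rat); rewrite intrM -!pmulrn.
rewrite -(tmap_sum_diag rat ab) /specht_rank.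
set gens := (X in <<X>>%VS); set U := <<gens>>%VS.
have US x : x \in U -> x \in specht_mem n lam rat.
  move=> /(@coord_span _ _ _ (in_tuple gens)) ->; apply: rpred_sum => i _.
  apply: rpredZ; have /mapP[d _ ->] : gens`_i \in gens by apply: mem_nth.
  exact: polytabloid_specht.
have SU x : x \in specht_mem n lam rat -> x \in U.
  move=> /asboolP[k ->]; apply: memv_suml => d _; apply: memvZ.
  by apply: memv_span; apply/mapP; exists d; rewrite ?mem_enum.
pose E (x : permmod n lam rat) : permmod n lam rat := tmap b a (tmap a b x).
pose X := vbasis U.
have EU x : E x \in U by apply: SU; apply: tmap_specht (transposed_sym ab) _ _.
have XU (i : 'I_(\dim U)) : X`_i \in U by apply: vbasis_mem; rewrite mem_nth ?size_tuple.
transitivity (\sum_t \sum_(i < \dim U)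
    coord X i (E (tabloid_vec rat t)) * (X`_i : permmod n lam rat) t); last first.
  apply: eq_bigr => t _; rewrite -/(E _) [in RHS](coord_vbasis (EU _)).
  by rewrite sum_ffunE; apply: eq_bigr => i _; rewrite [RHS]ffunE.
rewrite exchange_big /=.
transitivity (\sum_(i < \dim U) (hook_scalar a b)%:~R : rat).
  by rewrite sumr_const card_ord mulr_natr.
apply: eq_bigr => i _.
transitivity (coord X i (E X`_i)).
  rewrite /E (tmap_tmap ab (US _ (XU i))) linearZ /=.
  by rewrite (coord_free _ _ (basis_free (vbasisP U))) eqxx; exact/esym/mulr1.
rewrite [in LHS](permmod_sum (X`_i)) /E !linear_sum; apply: eq_bigr => t _.
by rewrite !linearZ /=; exact: mulrC.
Qed.

(** * Jantzen layers *)

(* Over 'F_p an additive bijection is linear. *)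
Lemma gmod_iso_of_rel p (gT : finGroupType) (Q1 Q2 : gmodType 'F_p gT)
    (X Y : zmodType) (c1 : X -> Q1) (c2 : Y -> Q2) (R : X -> Y -> Prop) :
  {morph c1 : x y / x - y} -> {morph c2 : x y / x - y} ->
  (forall q, exists x y, R x y /\ c1 x = q) ->
  (forall q, exists x y, R x y /\ c2 y = q) ->
  (forall x y x' y', R x y -> R x' y' -> R (x - x') (y - y')) ->
  (forall x y, R x y -> c1 x = 0 <-> c2 y = 0) ->
  (forall x y g, R x y -> exists x' y',
    [/\ R x' y', c1 x' = gact (c1 x) g & c2 y' = gact (c2 y) g]) ->
  gmod_iso Q1 Q2.
Proof.
move=> c1B c2B sur1 sur2 RB ker act.
have /boolp.choice[f fP] : forall q, exists r, exists x y, [/\ R x y, c1 x = q & c2 y = r].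
  by move=> q; have [x [y [xy e]]] := sur1 q; exists (c2 y), x, y.
(* [f] does not depend on the chosen pair: two pairs with the same first class differ by a pair in
   [R] whose classes both vanish. *)
have fE x y : R x y -> f (c1 x) = c2 y.
  move=> xy; have [x' [y' [xy' e <-]]] := fP (c1 x); apply/eqP; rewrite -subr_eq0.
  by rewrite -c2B; apply/eqP/(ker _ _ (RB _ _ _ _ xy' xy)); rewrite c1B e subrr.
have fB : {morph f : q r / q - r}.
  move=> q r; have [x [y [xy <-]]] := sur1 q; have [x' [y' [xy' <-]]] := sur1 r.
  by rewrite -c1B (fE _ _ (RB _ _ _ _ xy xy')) c2B (fE _ _ xy) (fE _ _ xy').
have f0 : f 0 = 0 by have := fB 0 0; rewrite !subrr.
have fD : {morph f : q r / q + r}.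
  by move=> q r; rewrite -{1}[r]opprK fB -[- r]sub0r fB f0 sub0r opprK.
have scaleE (V : lmodType 'F_p) (k : 'F_p) (w : V) : k *: w = w *+ k.
  by rewrite -scaler_nat natr_Zp.
have f_lin : linear f.
  move=> k q r; rewrite fD !scaleE; congr (_ + _).
  by elim: (nat_of_ord k) => [|m IH]; rewrite ?mulr0n // !mulrS fD IH.
pose fl := GRing.isLinear.Build _ _ _ _ f f_lin.
pose F : {linear Q1 -> Q2} := HB.pack f fl.
have finj : injective f.
  move=> q r; have [x [y [xy <-]]] := sur1 q; have [x' [y' [xy' <-]]] := sur1 r.
  rewrite (fE _ _ xy) (fE _ _ xy') => e; apply/eqP; rewrite -subr_eq0 -c1B; apply/eqP.
  by apply/(ker _ _ (RB _ _ _ _ xy xy')); rewrite c2B e subrr.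
have /boolp.choice[g gP] : forall r, exists q, f q = r.
  by move=> r; have [x [y [xy <-]]] := sur2 r; exists (c1 x); apply: fE.
exists F; split; first by exists g => [q|r] /=; [exact/finj/gP|exact: gP].
move=> q s; have [x [y [xy <-]]] := sur1 q; rewrite /= (fE _ _ xy).
by have [x' [y' [xy' <- <-]]] := act _ _ s xy; apply: fE.
Qed.

Section JantzenClass.
Variables (n : nat) (lam : seq nat) (p : nat) (p_pr : prime p) (i : nat).

Local Notation S := (specht n lam (Zloc p)).
Local Notation L := (jantzen_lattice n lam p).
Local Notation Q := (jantzen_quo n lam p_pr i).

Definition red_pmul (x : S) : specht_Fp n lam p_pr := quo_pi (pmul_submodule S p) x.

Lemma red_jantzen j (x : S) : x \in smem (L j) ->
  red_pmul x \in smem (jantzen n lam p_pr j).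
Proof. by move=> xL; apply/asboolP; exists x. Qed.

Definition jantzen_class (x : sub_gmod (L i)) : Q :=
  quo_pi (restrict (jantzen n lam p_pr i) (jantzen n lam p_pr i.+1))
    (SubGmod (red_jantzen (valP x))).

Lemma red_pmulB : {morph red_pmul : x y / x - y}.
Proof. by move=> x y; apply: (raddfB (quo_pi (pmul_submodule S p))). Qed.

Lemma red_pmul_eq x y : red_pmul x = red_pmul y <-> exists u, x - y = u *+ p.
Proof.
by split=> [/quo_piE/asboolP|h]; [|apply/quo_piE/asboolP].
Qed.

Lemma jantzen_classB : {morph jantzen_class : x y / x - y}.
Proof.
move=> x y; rewrite /jantzen_class -[RHS]raddfB; congr quo_pi.
by apply: val_inj; rewrite /= red_pmulB.
Qed.

Lemma jantzen_class_surj q : exists x, jantzen_class x = q.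
Proof.
rewrite -(quo_reprK q); set r := quo_repr q.
have /asboolP[x xL e] := valP r; exists (SubGmod xL).
by rewrite /jantzen_class; congr quo_pi; apply: val_inj.
Qed.

Lemma jantzen_class_sign (e : bool) x :
  jantzen_class ((-1) ^+ e *: x) = (-1) ^+ e *: jantzen_class x.
Proof.
have c0 : jantzen_class 0 = 0.
  by have := jantzen_classB 0 0; rewrite !subrr.
case: e; rewrite ?expr1 ?expr0 ?scale1r // !scaleN1r.
by rewrite -[- x]sub0r jantzen_classB c0 sub0r.
Qed.

Lemma jantzen_class_gact x s : jantzen_class (gact x s) = gact (jantzen_class x) s.
Proof.
rewrite [RHS]quo_piJ; congr quo_pi; apply: val_inj; rewrite /= [RHS]quo_piJ.
by [].
Qed.

(** This is the preimage of [jantzen i.+1] under reduction modulo p. *)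
Definition jantzen_null (x : S) : Prop :=
  exists x1 x2, x1 \in smem (L i.+1) /\ x = x1 + x2 *+ p.

Lemma jantzen_class_eq0 x : jantzen_class x = 0 <-> jantzen_null (val x).
Proof.
have -> : 0 = quo_pi (restrict (jantzen n lam p_pr i) (jantzen n lam p_pr i.+1)) 0.
  exact/esym/raddf0.
rewrite quo_piE subr0 inE /=; split=> [/asboolP[x1 x1L]|[x1 [x2 [x1L e]]]].
  move=> /red_pmul_eq[x2 e]; exists x1, x2; split=> //.
  by rewrite -e addrC subrK.
by apply/asboolP; exists x1 => //; apply/red_pmul_eq; exists x2; rewrite e addrC addKr.
Qed.

End JantzenClass.

Section SubVal.
Variables (k : nzRingType) (gT : finGroupType) (V : gmodType k gT) (M : submodule V).
Implicit Types x y : sub_gmod M.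

Lemma sub_valB x y : sub_val (x - y) = sub_val x - sub_val y.
Proof. exact: (raddfB val). Qed.

Lemma sub_valZ c x : sub_val (c *: x) = c *: sub_val x.
Proof. by []. Qed.

Lemma sub_val_gact x g : sub_val (gact x g) = gact (sub_val x) g.
Proof. by []. Qed.
End SubVal.

Lemma permmod_Zloc_scalerI p n lam (k : Zloc p) (x y : permmod n lam (Zloc p)) :
  k != 0 -> k *: x = k *: y -> x = y.
Proof.
move=> k0 e; apply/ffunP => t; apply: val_inj.
have vk0 : val k != 0 by apply: contraNneq k0 => e'; apply/eqP/val_inj.
apply: (mulfI vk0).
have : k * x t = k * y t.
  by have := congr1 (fun f : permmod n lam (Zloc p) => f t) e; rewrite !ffunE.
by move/(congr1 val).
Qed.

(** * Duality between the two conjugate shapes *)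

Section Duality.
Variables (p : nat) (p_pr : prime p) (v : nat) (U W : Zloc p) (UW : U * W = 1).
Local Notation pZ := (p%:R : Zloc p).

(** The graph of K^T / p^i, written without division. *)
Definition jantzen_rel n lam mu (a : tableau n lam) (b : tableau n mu) i
    (x : specht n lam (Zloc p)) (y : specht n mu (Zloc p)) : Prop :=
  tmap a b (sub_val x) = pZ ^+ i *: sub_val y.

(** Applying K to K^T x = p^i y gives p^v U x = p^i K y, and p^i cancels. *)
Lemma jantzen_rel_sym n lam mu (a : tableau n lam) (b : tableau n mu) i x y :
  transposed a b -> (hook_scalar a b)%:~R = pZ ^+ v * U -> (i <= v)%N ->
  jantzen_rel a b i x y -> jantzen_rel b a (v - i) y (U *: x).
Proof.
move=> ab g iv xy; apply: (permmod_Zloc_scalerI (Zloc_pX_neq0 p_pr i)).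
have := tmap_tmap ab (valP x); rewrite xy linearZ /= g => ->.
by rewrite !scalerA -exprD subnKC.
Qed.

Lemma jantzen_relB n lam mu (a : tableau n lam) (b : tableau n mu) i x y x' y' :
  jantzen_rel a b i x y -> jantzen_rel a b i x' y' ->
  jantzen_rel a b i (x - x') (y - y').
Proof.
by move=> xy xy'; rewrite /jantzen_rel !sub_valB raddfB /= xy xy' scalerBr.
Qed.

Lemma jantzen_relZ n lam mu (a : tableau n lam) (b : tableau n mu) i x y k :
  jantzen_rel a b i x y -> jantzen_rel a b i (k *: x) (k *: y).
Proof.
move=> xy; rewrite /jantzen_rel !sub_valZ linearZ /= xy !scalerA.
by congr (_ *: _); apply: mulrC.
Qed.

Lemma jantzen_rel_gact n lam mu (a : tableau n lam) (b : tableau n mu) i x y s :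
  jantzen_rel a b i x y -> jantzen_rel a b i (gact x s) ((-1) ^+ s *: gact y s).
Proof.
move=> xy; rewrite /jantzen_rel sub_valZ !sub_val_gact tmap_gact xy gactZ !scalerA.
by congr (_ *: _); apply: mulrC.
Qed.

Lemma jantzen_rel_mem n lam mu (a : tableau n lam) (b : tableau n mu) i x y :
  transposed a b -> jantzen_rel a b i x y -> x \in smem (jantzen_lattice n lam p i).
Proof. by move=> ab xy; apply/(jantzen_latticeP ab p_pr); exists y. Qed.

(** Write x = x1 + p x2 with K^T x1 = p^(i+1) y1. Then p x2 is related to y - p y1, and the reverse
    relation K (y - p y1) = p^(v-i) U p x2 puts y - p y1 in the lattice of index v - i + 1. *)
Lemma jantzen_rel_null n lam mu (a : tableau n lam) (b : tableau n mu) i x y :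
  transposed a b -> (hook_scalar a b)%:~R = pZ ^+ v * U -> (i <= v)%N ->
  jantzen_rel a b i x y -> jantzen_null i x -> jantzen_null (v - i) y.
Proof.
move=> ab g iv xy [x1 [x2 [/(jantzen_latticeP ab p_pr)[y1 e1] ex]]].
have e2 : jantzen_rel a b i (x2 *+ p) (y - y1 *+ p).
  rewrite /jantzen_rel; have -> : x2 *+ p = x - x1 by rewrite ex addrC addKr.
  rewrite !raddfB /= xy e1; congr (_ - _).
  by rewrite exprSr -scalerA scaler_nat; congr (_ *: _); apply/esym/(raddfMn val).
exists (y - y1 *+ p), y1; split; last by rewrite subrK.
apply/(jantzen_latticeP (transposed_sym ab) p_pr); exists (U *: x2).
have := jantzen_rel_sym ab g iv e2; rewrite /jantzen_rel => ->.
rewrite exprSr -scalerA scaler_nat; congr (_ *: _); rewrite -scalerMnr.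
exact: (raddfMn val).
Qed.

Lemma jantzen_quo_iso n lam mu (a : tableau n lam) (b : tableau n mu) i :
  transposed a b -> (hook_scalar a b)%:~R = pZ ^+ v * U -> (i <= v)%N ->
  gmod_iso (jantzen_quo n lam p_pr i) (sign_twist (jantzen_quo n mu p_pr (v - i))).
Proof.
move=> ab g iv; have ba := transposed_sym ab.
have g' : (hook_scalar b a)%:~R = pZ ^+ v * U by rewrite hook_scalarC.
have vi : (v - i <= v)%N := leq_subr i v.
pose LX := sub_gmod (jantzen_lattice n lam p i).
pose LY := sub_gmod (jantzen_lattice n mu p (v - i)).
pose R (x : LX) (y : LY) := jantzen_rel a b i (sub_val x) (sub_val y).
have RE x y : jantzen_rel a b i x y -> exists2 xy : LX * LY, R xy.1 xy.2 &
    sub_val xy.1 = x /\ sub_val xy.2 = y.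
  move=> xy; have xL := jantzen_rel_mem ab xy.
  have yL := jantzen_rel_mem ba (jantzen_rel_sym ab g iv xy).
  by exists (SubGmod xL, SubGmod yL).
have RX x : exists y, R x y.
  have [y xy] := (jantzen_latticeP ab p_pr i _).1 (valP x).
  have [[x' y'] /= xy' [/val_inj <- _]] := RE _ _ xy; by exists y'.
have RY y : exists x, R x y.
  have [x yx] := (jantzen_latticeP ba p_pr _ _).1 (valP y).
  have := jantzen_rel_sym ba g' vi yx; rewrite subKn // => xy.
  (* The reverse relation ends at [U] times the wanted element; scaling by the inverse [W] corrects
     this. *)
  have xy' : jantzen_rel a b i (W *: x) (sub_val y).
    by have := jantzen_relZ W xy; rewrite scalerA mulrC UW scale1r.
  have [[x' y'] /= xy'' [_ /val_inj <-]] := RE _ _ xy'; by exists x'.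
pose cX (x : LX) : jantzen_quo n lam p_pr i := jantzen_class p_pr x.
pose cY (y : LY) : sign_twist (jantzen_quo n mu p_pr (v - i)) := jantzen_class p_pr y.
refine (gmod_iso_of_rel (c1 := cX) (c2 := cY) (R := R) _ _ _ _ _ _ _).
- exact: jantzen_classB.
- exact: jantzen_classB.
- by move=> q; have [x <-] := jantzen_class_surj q; have [y xy] := RX x; exists x, y.
- by move=> q; have [y <-] := jantzen_class_surj q; have [x xy] := RY y; exists x, y.
- by move=> x y x' y' xy xy'; rewrite /R !sub_valB; apply: jantzen_relB.
- move=> x y xy; split=> [/jantzen_class_eq0 x0|/jantzen_class_eq0 y0].
    by apply/jantzen_class_eq0; apply: jantzen_rel_null ab g iv xy x0.
  apply/jantzen_class_eq0; have yx := jantzen_rel_sym ab g iv xy.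
  have [x1 [x2 [x1L e]]] := jantzen_rel_null ba g' vi yx y0.
  rewrite subKn // in x1L; exists (W *: x1), (W *: x2); split; first exact: rpredZ.
  by rewrite scalerMnr -scalerDr -e scalerA mulrC UW scale1r.
- move=> x y s xy; exists (gact x s), ((-1) ^+ s *: gact y s); split.
  + by rewrite /R sub_valZ !sub_val_gact; apply: jantzen_rel_gact.
  + exact: jantzen_class_gact.
  + by rewrite /cY jantzen_class_sign jantzen_class_gact.
Qed.

(** For i > v, the equation p^v U x = p^i K y shows that p divides x. *)
Lemma jantzen_quo_trivial n lam mu (a : tableau n lam) (b : tableau n mu) i
    (q : jantzen_quo n lam p_pr i) :
  transposed a b -> (hook_scalar a b)%:~R = pZ ^+ v * U -> (v < i)%N -> q = 0.
Proof.
move=> ab g vi; have [x <-] := jantzen_class_surj q; apply/jantzen_class_eq0.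
have [y xy] := (jantzen_latticeP ab p_pr i _).1 (valP x).
(* The positive exponent i - v is written as a successor, to split off one factor p. *)
have iE : i = (v + (i - v).-1.+1)%N by rewrite prednK ?subn_gt0 // subnKC // ltnW.
have zS : tmap b a (sub_val y) \in specht_mem n lam (Zloc p).
  exact: tmap_specht (transposed_sym ab) _ _.
pose z : specht n lam (Zloc p) := @SubGmod _ _ _ (specht_submodule n lam (Zloc p)) _ zS.
have e : U *: sub_val (sub_val x) = pZ ^+ (i - v).-1.+1 *: sub_val z.
  apply: (permmod_Zloc_scalerI (Zloc_pX_neq0 p_pr v)).
  have := tmap_tmap ab (valP (sub_val x)); rewrite xy linearZ /= g => e.
  by rewrite !scalerA -exprD -iE e.
have {}e : U *: sub_val x = (pZ ^+ (i - v).-1 *: z) *+ p.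
  by apply: val_inj; rewrite /= e -scaler_nat scalerA -exprS.
exists 0, (W *: (pZ ^+ (i - v).-1 *: z)); split; first exact: rpred0.
by rewrite scalerMnr -e scalerA mulrC UW scale1r add0r.
Qed.


End Duality.

Theorem proposition4p1 (n p : nat) (lam : seq nat)
    (n_gt0 : (0 < n)%N) (p_pr : prime p) (lamP : is_part n lam) :
  let v := logn p (n`! %/ specht_rank n lam) in
  (forall i : nat, (i <= v)%N ->
     gmod_iso (jantzen_quo n lam p_pr i)
              (sign_twist (jantzen_quo n (conj_part lam) p_pr (v - i))))
  /\ (forall i : nat, (v < i)%N ->
     forall x : jantzen_quo n lam p_pr i, x = 0).
Proof.
have [a [b ab]] := exists_transposed lamP.
have hr := hook_scalar_rank ab.
have rank_gt0 : (0 < specht_rank n lam)%N.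
  rewrite lt0n; apply/eqP => r0; have := fact_gt0 n.
  by move: hr; rewrite r0 mulr0 => -[<-].
(* The product with the positive rank is positive, so the scalar is a natural number [h], and the
   quotient defining [v] is exactly [h]. *)
have [h hE hN] : exists2 h : nat, hook_scalar a b = h & (h * specht_rank n lam = n`!)%N.
  have : 0 <= hook_scalar a b.
    by rewrite -(pmulr_lge0 _ (_ : 0 < (specht_rank n lam)%:Z)) ?hr.
  case: (hook_scalar a b) hr => // h [hr] _; by exists h.
move=> v; have vE : v = logn p h by rewrite /v -hN mulnK.
have h_gt0 : (0 < h)%N by have := fact_gt0 n; rewrite -hN muln_gt0 => /andP[].
have [u pu hu] := pfactor_coprime p_pr h_gt0.
have u0 : u%:R != 0 :> rat.
  by rewrite pnatr_eq0; apply: contraTneq h_gt0 => u0; rewrite hu u0 mul0n.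
(* The prime-to-p part [u] of [h] is a unit of Z_(p). *)
pose W : Zloc p := MkZloc (Zloc_frac 1 pu).
have UW : u%:R * W = 1.
  pose f := GRing.RMorphism.clone _ _ (val : Zloc p -> rat) _.
  apply: val_inj; apply: (etrans (rmorphM f _ _)).
  by rewrite rmorph_nat /= mul1r divff.
have g : (hook_scalar a b)%:~R = (p%:R : Zloc p) ^+ v * u%:R.
  by rewrite hE -pmulrn {1}hu natrM natrX mulrC vE.
split=> i iv; first by have := jantzen_quo_iso p_pr UW ab g iv.
by move=> x; apply: (jantzen_quo_trivial UW x ab g iv).
Qed.
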